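(* Let $F:\mathbb{R}^n\to\mathbb{R}^n$ be a real analytic vector field whose Jacobian is symmetric at every point (respectively, skew-symmetric at every point). Let $H:\mathbb{R}^n\times\mathbb{R}^n\to\mathbb{R}$, $(v,u)\mapsto H(v,u)$, be a real analytic function with $\nabla_1H(F(u),u)=0$ for all $u\in\mathbb{R}^n$. Suppose that for some trajectory $\gamma$ of $\dot u=F(u)$ there exist an analytic submanifold $\mathcal{S}\subseteq\mathbb{R}^n$ and a point $p\in\mathcal{S}\subseteq\overline{\gamma}$ such that $\ker\nabla_1^2H(F(p),p)\subseteq T_p\mathcal{S}$. Then $F$, with conservation law $H$, is discoverable within the space of analytic vector fields with symmetric (respectively, skew-symmetric) Jacobian.
   Context: $\nabla_1H$ and $\nabla_1^2H$ denote the gradient and Hessian of $H$ with respect to its first vector argument $v$. A trajectory $\gamma$ is (the image of) a solution of $\dot u=F(u)$; $\overline\gamma$ is its closure in $\mathbb{R}^n$. $F$, with conservation law $H$, is discoverable within the space $V$ of analytic vector fields on $\mathbb{R}^n$ with symmetric (resp. skew-symmetric) Jacobian if there is a solution $u$ of $\dot u=F(u)$ such that $F$ is the only $G\in V$ satisfying both $\dot u=G(u)$ and the conservation law $\nabla_1H(G(w),w)=0$ for all $w\in\mathbb{R}^n$. *)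

(* Defs.v *)
From mathcomp Require Import all_boot all_order all_algebra.
From mathcomp Require Import all_classical all_reals all_analysis.
From mathcomp.analysis.showcase Require summability.
Import Order.TTheory GRing.Theory Num.Theory.
Import numFieldNormedType.Exports.

Set Implicit Arguments.
Unset Strict Implicit.
Unset Printing Implicit Defensive.

Local Open Scope classical_set_scope.
Local Open Scope ring_scope.

(* Convergence along [totally] is convergence of the net of all finite partial
   sums, that is, absolute convergence of the power series
   sum_alpha c_alpha (y - x)^alpha; multi-indices are finite functions. *)
Definition analytic_at (R : realType) (n : nat)
    (f : 'rV[R]_n -> R) (x : 'rV[R]_n) : Prop :=
  exists c : {ffun 'I_n -> nat} -> R,
    \forall y \near x,
      summability.partial_sum
        (fun alpha : {ffun 'I_n -> nat} =>
           c alpha * \prod_(i < n) (y - x) 0 i ^+ alpha i)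
        @ summability.totally --> f y.

Definition analytic_on (R : realType) (n m : nat)
    (U : set 'rV[R]_n) (f : 'rV[R]_n -> 'rV[R]_m) : Prop :=
  forall x, U x -> forall j : 'I_m, analytic_at (fun y => f y 0 j) x.

Definition analytic_field (R : realType) (n : nat)
    (F : 'rV[R]_n -> 'rV[R]_n) : Prop :=
  analytic_on setT F.

Definition analytic_function2 (R : realType) (n : nat)
    (H : 'rV[R]_n -> 'rV[R]_n -> R) : Prop :=
  forall z : 'rV[R]_(n + n),
    analytic_at (fun y : 'rV[R]_(n + n) => H (lsubmx y) (rsubmx y)) z.

(* The library's ['J F x] acts on row vectors, so it is the transpose of the
   usual Jacobian matrix; both conditions below are invariant under this. *)
Definition symmetric_fields (R : realType) (n : nat) :
    set ('rV[R]_n -> 'rV[R]_n) :=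
  [set G | analytic_field G /\ forall x : 'rV[R]_n, ('J G x)^T = 'J G x].

Definition skew_symmetric_fields (R : realType) (n : nat) :
    set ('rV[R]_n -> 'rV[R]_n) :=
  [set G | analytic_field G /\ forall x : 'rV[R]_n, ('J G x)^T = - 'J G x].

Definition gradient (R : realType) (n : nat)
    (f : 'rV[R]_n -> R^o) (x : 'rV[R]_n) : 'rV[R]_n :=
  \row_(i < n) 'D_(delta_mx 0 i) f x.

Definition hessian (R : realType) (n : nat)
    (f : 'rV[R]_n -> R^o) (x : 'rV[R]_n) : 'M[R]_n :=
  \matrix_(i < n, j < n) 'D_(delta_mx 0 i) ('D_(delta_mx 0 j) f) x.

Definition conservation_law (R : realType) (n : nat)
    (H : 'rV[R]_n -> 'rV[R]_n -> R) (G : 'rV[R]_n -> 'rV[R]_n) : Prop :=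
  forall w, gradient (H^~ w) (G w) = 0.

(* Solutions need not be global in time: [u] solves the equation on the
   nonempty open, possibly unbounded, interval [I]; its values outside [I] are
   irrelevant, and its trajectory is [u @` I]. *)
Definition solution (R : realType) (n : nat) (F : 'rV[R]_n -> 'rV[R]_n)
    (I : set R) (u : R -> 'rV[R]_n) : Prop :=
  [/\ open I, is_interval I, I !=set0 &
      forall t, I t -> is_derive (t : R^o) (1 : R^o) u (F (u t))].

(* Embedded submanifolds, through slice charts: near each of its points, an
   analytic diffeomorphism [phi : U -> V] between open sets maps [S] onto the
   points of [V] whose coordinates of index at least [k] vanish. *)
Definition analytic_submanifold (R : realType) (n : nat)
    (S : set 'rV[R]_n) : Prop :=
  exists2 k : nat, (k <= n)%N &
    forall q, S q ->
      exists (U V : set 'rV[R]_n) (phi psi : 'rV[R]_n -> 'rV[R]_n),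
        [/\ open U /\ open V, U q,
            (forall x, U x -> V (phi x) /\ psi (phi x) = x) /\
            (forall y, V y -> U (psi y) /\ phi (psi y) = y),
            analytic_on U phi /\ analytic_on V psi &
            forall x, U x -> S x <-> forall i : 'I_n, (k <= i)%N -> phi x 0 i = 0].

(* Velocities at [p] of differentiable curves in [S] through [p]. *)
Definition tangent_space (R : realType) (n : nat)
    (S : set 'rV[R]_n) (p : 'rV[R]_n) : set 'rV[R]_n :=
  [set v | exists c : R -> 'rV[R]_n,
     [/\ c 0 = p,
         \forall t \near (0 : R), S (c t) /\ derivable c (t : R^o) (1 : R^o) &
         is_derive (0 : R^o) (1 : R^o) c v]].

Definition discoverable (R : realType) (n : nat)
    (V : set ('rV[R]_n -> 'rV[R]_n)) (F : 'rV[R]_n -> 'rV[R]_n)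
    (H : 'rV[R]_n -> 'rV[R]_n -> R) : Prop :=
  exists (I : set R) (u : R -> 'rV[R]_n),
    solution F I u /\
    forall G : 'rV[R]_n -> 'rV[R]_n,
      [/\ V G, solution G I u & conservation_law H G] <-> G = F.

(* Main.v *)
Require Import Defs.
From mathcomp Require Import all_boot all_order all_algebra finmap.
From mathcomp Require Import all_classical all_reals all_analysis.
From mathcomp.analysis.showcase Require summability.
From mathcomp Require Import ring lra.
Import Order.TTheory GRing.Theory Num.Theory.
Import numFieldNormedType.Exports.

Local Open Scope classical_set_scope.
Local Open Scope ring_scope.

Set Implicit Arguments.
Unset Strict Implicit.
Unset Printing Implicit Defensive.

(**
Let [G] be a second field with the same symmetry of the Jacobian that has the
same solution [u] and the same conservation law, and put [d := G - F].  By
uniqueness of derivatives [d] vanishes on the trajectory, hence by continuity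
on its closure and on [S].  Because everything is analytic, it is enough to
show that [d] vanishes at [p] to every order
([vanishing_analytic_eq0], [analytic_identity]).

Suppose that [d] vanishes at [p] to order [k >= 1], and let [d_k] be the
homogeneous part of degree [k] of its Taylor expansion at [p].  Write [A] for
the Hessian of [H(-, p)] at [F p] and [K] for its kernel.

- Subtracting the conservation laws of [F] and [G] and applying the mean value
  theorem to the gradient of [H] in its first argument gives [A d = 0] up to
  order [k + 1] ([hessian_kills_difference]).
- Let [z = b A] be in the row space of [A].  The symmetry of the Jacobian turns
  the derivative of each coordinate of [d] along [z] into, up to sign, a partial
  derivative of the scalar [z . d = b . (A d)].  The latter vanishes to order
  [k + 1], so its derivative vanishes to order [k] ([vanishing_derive]), and
  the mean value theorem yields [d_k (x + z) = d_k x] ([taylor_term_shift]).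
- A vector [v] of [K] is the velocity at [p] of a curve in [S], on which [d]
  vanishes; comparing leading terms along this curve gives [d_k v = 0]
  ([taylor_leading_curve]).

Every vector is the sum of one in [K] and one in the row space of [A]
([kernel_row_decomposition]), so [d_k = 0] and [d] vanishes to order [k + 1]
([vanishing_order_step]).  This treats symmetric and skew-symmetric Jacobians
at once; the sign is the parameter [sg].

The analytic input is that a power series may be differentiated term by term
([derived_series_cvg]); it shows that partial derivatives of analytic functions
are analytic and commute, and everything else about higher derivatives is
expressed through orders of vanishing.
*)

(** * Unconditional sums *)

Lemma partial_sumE (R : realType) (I : choiceType) (u : I -> R) (A : {fset I}) :
  summability.partial_sum u A = \sum_(i <- A) u i.
Proof. by rewrite /summability.partial_sum big_seq_fsetE. Qed.

Lemma totally_cvgP (R : realType) (I : choiceType) (u : I -> R) (l : R) :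
  summability.partial_sum u @ summability.totally --> l <->
  forall e, 0 < e -> exists A0 : {fset I}, forall A : {fset I},
    (A0 `<=` A)%fset -> `|l - \sum_(i <- A) u i| <= e.
Proof.
have FF := @summability.totally_filter I.
split=> [/cvgrPdist_le ul e e0 | H].
  have [A0 _ A0P] := ul e e0.
  by exists A0 => A A0A; rewrite -partial_sumE; exact: A0P.
apply/cvgrPdist_le => e e0; have [A0 A0P] := H e e0.
by exists A0 => // A A0A; rewrite /= partial_sumE; exact: A0P.
Qed.

Lemma sum_fsetU (R : realType) (I : choiceType) (u : I -> R) (A B : {fset I}) :
  \sum_(i <- (A `|` B)%fset) u i
    = \sum_(i <- A) u i + \sum_(i <- B | i \notin A) u i.
Proof.
rewrite (bigID (mem A)) /=; congr (_ + _).
  rewrite big_fset_condE; congr (\sum_(i <- _) u i).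
  by apply: congr1; apply/fsetP => x; rewrite !inE; case: (x \in A); rewrite ?andbF.
rewrite big_fset_condE [RHS]big_fset_condE; congr (\sum_(i <- _) u i).
by apply: congr1; apply/fsetP => x; rewrite !inE; case: (x \in A); rewrite ?andbF.
Qed.

(** A net of finite partial sums that converges is bounded on all finite sets: any
finite [A] can be completed to one beyond which the sums are close to the limit,
and what is added lies in one fixed finite set.  Bounding the nonnegative and
the negative terms apart then bounds the sums of absolute values. *)
Lemma absolutely_bounded (R : realType) (I : choiceType) (u : I -> R) (l : R) :
  summability.partial_sum u @ summability.totally --> l ->
  exists B, forall A : {fset I}, \sum_(i <- A) `|u i| <= B.
Proof.
move=> /totally_cvgP /(_ 1 ltr01)[A0 A0P].
pose M : R := `|l| + 1 + \sum_(i <- A0) `|u i|.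
have bnd (A : {fset I}) : `|\sum_(i <- A) u i| <= M.
  have -> : \sum_(i <- A) u i =
      \sum_(i <- (A `|` A0)%fset) u i - \sum_(i <- A0 | i \notin A) u i.
    by rewrite sum_fsetU addrK.
  apply: le_trans (ler_normB _ _) _; apply: lerD.
    have := A0P _ (fsubsetUr A A0); set s := \sum_(_ <- _) _ => ls.
    have -> : s = l - (l - s) by rewrite opprB addrCA subrr addr0.
    by apply: le_trans (ler_normB _ _) _; rewrite lerD2l.
  apply: le_trans (ler_norm_sum _ _ _) _.
  by rewrite [leRHS](bigID (mem A)) /= lerDr sumr_ge0.
(* [M] bounds every finite sum, so each sign contributes at most [M]. *)
exists (M + M) => A; rewrite (bigID (fun i => 0 <= u i)) /=; apply: lerD.
  rewrite (eq_bigr u) => [|i /ger0_norm //].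
  by rewrite big_fset_condE; apply: le_trans (ler_norm _) (bnd _).
rewrite (eq_bigr (fun i => - u i)) => [|i]; last by rewrite -ltNge => /ltr0_norm.
by rewrite sumrN big_fset_condE; apply: le_trans _ (bnd _); rewrite -normrN; exact: ler_norm.
Qed.

Lemma tail_bound (R : realType) (I : choiceType) (u : I -> R) (l M : R)
    (A0 : {fset I}) :
  summability.partial_sum u @ summability.totally --> l ->
  (forall A : {fset I}, \sum_(i <- A | i \notin A0) `|u i| <= M) ->
  `|l - \sum_(i <- A0) u i| <= M.
Proof.
move=> /totally_cvgP ul uM; apply/ler_addgt0Pr => e e0.
have [A1 A1P] := ul e e0.
have /A1P := fsubsetUr A0 A1; rewrite sum_fsetU.
set s := \sum_(_ <- A0) _; set t := \sum_(_ <- A1 | _) _ => lst.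
have -> : l - s = t + (l - (s + t)) by ring.
apply: le_trans (ler_normD _ _) _; apply: lerD => //.
by apply: le_trans (ler_norm_sum _ _ _) _; apply: uM.
Qed.

(** * Multivariate power series and their homogeneous parts *)

Notation multi_index n := {ffun 'I_n -> nat}.

Definition mdeg (n : nat) (a : multi_index n) : nat := (\sum_(i < n) a i)%N.

Definition monomial (R : realType) (n : nat) (a : multi_index n)
    (x : 'rV[R]_n) : R :=
  \prod_(i < n) x 0 i ^+ a i.

Lemma norm_coord (R : realType) (n : nat) (x : 'rV[R]_n) (i : 'I_n) :
  `|x 0 i| <= `|x|.
Proof.
rewrite [leRHS]/Num.Def.normr/= mx_normrE.
exact: (le_bigmax _ (fun ij : 'I_1 * 'I_n => `|x ij.1 ij.2|) (0, i)).
Qed.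

Lemma norm_row_le (R : realType) (n : nat) (x : 'rV[R]_n) (b : R) :
  0 <= b -> (forall i, `|x 0 i| <= b) -> `|x| <= b.
Proof.
move=> b0 xb; rewrite [leLHS]/Num.Def.normr/= mx_normrE.
by apply: bigmax_le => // -[i j] _ /=; rewrite ord1.
Qed.

Lemma norm_monomial_le (R : realType) (n : nat) (a : multi_index n)
    (x : 'rV[R]_n) (b : R) :
  `|x| <= b -> `|monomial a x| <= b ^+ mdeg a.
Proof.
move=> xb; rewrite /monomial normr_prod /mdeg expr_sum.
apply: ler_prod => i _; rewrite normr_ge0 normrX /=.
by apply: lerXn2r; rewrite ?nnegrE //; 
   [exact: le_trans (normr_ge0 _) xb | exact: le_trans (norm_coord _ _) xb].
Qed.

Lemma monomialZ (R : realType) (n : nat) (a : multi_index n) (t : R)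
    (x : 'rV[R]_n) :
  monomial a (t *: x) = t ^+ mdeg a * monomial a x.
Proof.
rewrite /monomial /mdeg expr_sum -big_split /=.
by apply: eq_bigr => i _; rewrite mxE exprMn.
Qed.

Lemma monomial_const (R : realType) (n : nat) (a : multi_index n) (r : R) :
  monomial a (const_mx r) = r ^+ mdeg a.
Proof.
by rewrite /monomial /mdeg expr_sum; apply: eq_bigr => i _; rewrite mxE.
Qed.

(** Besides the sum itself, [r] and [B] record a uniform bound on the absolute
partial sums at the corner [(r, ..., r)]; it dominates the series on the whole
closed ball of radius [r]. *)
Definition power_series (R : realType) (n : nat) (f : 'rV[R]_n -> R)
    (x0 : 'rV[R]_n) (c : multi_index n -> R) (r B : R) : Prop :=
  [/\ 0 < r,
      forall A : {fset multi_index n}, \sum_(a <- A) `|c a| * r ^+ mdeg a <= B &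
      forall x, `|x| <= r ->
        summability.partial_sum (fun a => c a * monomial a x)
          @ summability.totally --> f (x0 + x)].

(** Convergence at the corner [(r, ..., r)] of a small cube already gives the bound
[B], because there every monomial is a power of [r]. *)
Lemma near_power_series (R : realType) (n : nat) (f : 'rV[R]_n -> R)
    (x0 : 'rV[R]_n) (c : multi_index n -> R) :
  (\forall y \near x0, summability.partial_sum (fun a => c a * monomial a (y - x0))
     @ summability.totally --> f y) ->
  exists r B, power_series f x0 c r B.
Proof.
move=> /nbhs_ballP[e /= e0 H].
pose r := e / 2; have r0 : 0 < r by rewrite divr_gt0.
have cvgf x : `|x| <= r ->
    summability.partial_sum (fun a => c a * monomial a x)
      @ summability.totally --> f (x0 + x).
  move=> xr; have := H (x0 + x).
  rewrite addrAC subrr add0r; apply.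
  rewrite -ball_normE /= opprD addrA subrr add0r normrN.
  by apply: le_lt_trans xr _; rewrite ltr_pdivrMr // ltr_pMr // ltr1n.
have nr : `|const_mx r : 'rV[R]_n| <= r.
  by apply: norm_row_le => [|i]; [exact: ltW | rewrite mxE gtr0_norm].
have [B BP] := absolutely_bounded (cvgf _ nr).
exists r, B; split=> // A; apply: le_trans (BP A).
rewrite le_eqVlt; apply/orP; left; apply/eqP; apply: eq_bigr => a _.
by rewrite normrM monomial_const normrX (gtr0_norm r0).
Qed.

Lemma analytic_power_series (R : realType) (n : nat) (f : 'rV[R]_n -> R)
    (x0 : 'rV[R]_n) :
  analytic_at f x0 -> exists c r B, power_series f x0 c r B.
Proof.
by move=> [c /near_power_series[r [B cf]]]; exists c, r, B.
Qed.

Lemma power_series_analytic (R : realType) (n : nat) (f : 'rV[R]_n -> R)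
    (x0 : 'rV[R]_n) c (r B : R) :
  power_series f x0 c r B -> analytic_at f x0.
Proof.
move=> [r0 _ cf]; exists c; apply/nbhs_ballP; exists r => //= y.
rewrite -ball_normE /= distrC => /ltW /cf.
by rewrite addrCA subrr addr0.
Qed.

(** Indices of total degree below [m] have all entries below [m], so they are
finitely many. *)
Definition low_degree (n m : nat) : {fset multi_index n} :=
  [fset a in codom (fun g : {ffun 'I_n -> 'I_m} =>
                      [ffun i => val (g i)] : multi_index n) | (mdeg a < m)%N]%fset.

Lemma in_low_degree n m (a : multi_index n) :
  (a \in low_degree n m) = (mdeg a < m)%N.
Proof.
rewrite /low_degree !inE /=; apply: andb_idl => am.
have h i : (a i < m)%N.
  by apply: leq_ltn_trans am; rewrite /mdeg (bigD1 i) //= leq_addr.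
apply/codomP; exists [ffun i => Ordinal (h i)].
by apply/ffunP => i; rewrite !ffunE.
Qed.

Definition homogeneous_part (R : realType) (n : nat) (c : multi_index n -> R) (k : nat)
    (x : 'rV[R]_n) : R :=
  \sum_(a <- low_degree n k.+1 | mdeg a == k) c a * monomial a x.

Lemma sum_low_degree (R : realType) (n : nat) (c : multi_index n -> R) (m : nat)
    (x : 'rV[R]_n) :
  \sum_(a <- low_degree n m) c a * monomial a x = \sum_(k < m) homogeneous_part c k x.
Proof.
pose u a := c a * monomial a x.
transitivity (\sum_(a <- low_degree n m) \sum_(k < m | mdeg a == k) u a).
  apply: eq_big_seq => a; rewrite in_low_degree => am.
  by rewrite (big_pred1 (Ordinal am)).
rewrite (exchange_big_dep xpredT) //=; apply: eq_bigr => k _.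
rewrite /homogeneous_part.
move: (@in_low_degree n m) (@in_low_degree n k.+1).
move: (low_degree n m) (low_degree n k.+1) => L L' inL inL'.
rewrite big_fset_condE [RHS]big_fset_condE.
congr (\sum_(i <- _) u i); apply: congr1; apply/fsetP => a.
rewrite !inE inL inL'; case: eqP => [->|]; last by rewrite !andbF.
by rewrite ltn_ord ltnS leqnn.
Qed.

(** A monomial of degree at least [m] is smaller at [x] than at the corner of the
polydisc of radius [r], at least by the factor [(|x| / r) ^ m]. *)
Lemma power_series_taylor (R : realType) (n : nat) (f : 'rV[R]_n -> R)
    (x0 : 'rV[R]_n) c (r B : R) (m : nat) (x : 'rV[R]_n) :
  power_series f x0 c r B -> `|x| <= r ->
  `|f (x0 + x) - \sum_(k < m) homogeneous_part c k x| <= B * (`|x| / r) ^+ m.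
Proof.
move=> [r0 cB cf] xr; rewrite -sum_low_degree.
apply: tail_bound (cf x xr) _ => A.
have q0 : 0 <= `|x| / r by rewrite divr_ge0 // ltW.
have q1 : `|x| / r <= 1 by rewrite ler_pdivrMr // mul1r.
apply: (@le_trans _ _ (\sum_(a <- A | a \notin low_degree n m)
    `|c a| * r ^+ mdeg a * (`|x| / r) ^+ m)).
  apply: ler_sum => a; rewrite in_low_degree -leqNgt => ma.
  rewrite normrM -mulrA ler_wpM2l //.
  apply: le_trans (norm_monomial_le _ (lexx _)) _.
  have {1}-> : `|x| = r * (`|x| / r) by rewrite mulrCA divff ?mulr1 // gt_eqF.
  by rewrite exprMn ler_wpM2l ?exprn_ge0 ?(ltW r0) // ler_wiXn2l.
rewrite -mulr_suml ler_wpM2r ?exprn_ge0 //.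
apply: le_trans (cB A); rewrite [leRHS](bigID (mem (low_degree n m))) /=.
by rewrite lerDr sumr_ge0 // => a _; rewrite mulr_ge0 ?exprn_ge0 // ltW.
Qed.

Lemma homogeneous_partZ (R : realType) (n : nat) (c : multi_index n -> R) k t (x : 'rV[R]_n) :
  homogeneous_part c k (t *: x) = t ^+ k * homogeneous_part c k x.
Proof.
rewrite /homogeneous_part mulr_sumr; apply: eq_bigr => a /eqP <-.
by rewrite monomialZ mulrCA.
Qed.

(** * Differentiability of analytic functions *)

Lemma differentiable_prod (R : realType) (V : normedModType R) (I : Type)
    (s : seq I) (f : I -> V -> R^o) (x : V) :
  (forall i, differentiable (f i) x) ->
  differentiable (fun y => \prod_(i <- s) f i y : R^o) x.
Proof.
move=> df; elim: s => [|i s IH].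
  rewrite (_ : (fun _ => _) = cst 1); first exact: differentiable_cst.
  by apply/funext => y; rewrite big_nil.
rewrite (_ : (fun _ => _) = f i * (fun y => \prod_(i <- s) f i y)).
  exact: differentiableM.
by apply/funext => y; rewrite big_cons.
Qed.

Lemma differentiable_bigsum (R : realType) (V : normedModType R) (I : Type)
    (s : seq I) (p : pred I) (f : I -> V -> R^o) (x : V) :
  (forall i, differentiable (f i) x) ->
  differentiable (fun y => \sum_(i <- s | p i) f i y : R^o) x.
Proof.
move=> df; elim: s => [|i s IH].
  rewrite (_ : (fun _ => _) = cst 0); first exact: differentiable_cst.
  by apply/funext => y; rewrite big_nil.
case pi : (p i).
  rewrite (_ : (fun _ => _) = f i + (fun y => \sum_(i <- s | p i) f i y)).
    exact: differentiableD.
  by apply/funext => y; rewrite big_cons pi.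
rewrite (_ : (fun _ => _) = (fun y => \sum_(i <- s | p i) f i y)) //.
by apply/funext => y; rewrite big_cons pi.
Qed.

Lemma homogeneous_part_differentiable (R : realType) (n : nat) (c : multi_index n -> R) k
    (x : 'rV[R]_n) :
  differentiable (homogeneous_part c k : 'rV[R]_n -> R^o) x.
Proof.
apply: differentiable_bigsum => a; apply: differentiableM.
  exact: differentiable_cst.
apply: differentiable_prod => i.
case: (a i) => [|m].
  rewrite (_ : (fun _ => _) = cst 1); first exact: differentiable_cst.
  by apply/funext => y; rewrite expr0.
rewrite (_ : (fun _ => _) = (fun y : 'rV[R]_n => y 0 i : R) ^+ m.+1).
  by apply: differentiableX; exact: differentiable_coord.
apply/funext => y; elim: m.+1 => [|l IH]; first by rewrite !expr0.
by rewrite !exprS IH.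
Qed.

Lemma quadratic_differentiable (R : realType) (V : normedModType R)
    (g : V -> R^o) (x : V) (C : R) :
  (\forall h \near (0 : V), `|g (x + h)| <= C * `|h| ^+ 2) -> differentiable g x.
Proof.
move=> gC.
have gx : g x = 0.
  have := nbhs_singleton gC; rewrite addr0 normr0 expr0n mulr0 normr_le0.
  by move/eqP.
have E : g \o shift x = cst (g x) + (\0 : {linear V -> R^o}) +o_ 0 id.
  apply/eqaddoP => e e0; near=> h.
  rewrite /= gx !fctE /= !addr0 subr0 addrC.
  have h1 : `|g (x + h)| <= C * `|h| ^+ 2 by near: h.
  apply: le_trans h1 _; rewrite expr2 mulrA ler_wpM2r //.
  apply: (@le_trans _ _ ((`|C| + 1) * `|h|)).
    by rewrite ler_wpM2r // (le_trans (ler_norm _)) // lerDl.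
  rewrite -ler_pdivlMl ?ltr_pwDr //.
  near: h; apply: nbhs0_le.
  by rewrite mulr_gt0 // invr_gt0 ltr_pwDr.
have cz : continuous (\0 : {linear V -> R^o}) by move=> y; exact: cst_continuous.
apply/diff_locallyP; rewrite (diff_unique cz E); split => //.
Unshelve. all: by end_near. Qed.

(** * Taylor expansions *)

(** What the study of orders of vanishing needs from the power series of [f] at
[x0]: [P k] is its homogeneous part of degree [k].  The remainder bound is
geometric in [m], so that it also controls the sum of the whole series. *)
Definition taylor_expansion (R : realType) (n : nat) (f : 'rV[R]_n -> R)
    (x0 : 'rV[R]_n) (P : nat -> 'rV[R]_n -> R) (r B : R) : Prop :=
  [/\ 0 < r /\ 0 <= B,
      forall k x, differentiable (P k : 'rV[R]_n -> R^o) x,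
      forall k t x, P k (t *: x) = t ^+ k * P k x &
      forall m x, `|x| <= r ->
        `|f (x0 + x) - \sum_(k < m) P k x| <= B * (`|x| / r) ^+ m].

Lemma analytic_taylor (R : realType) (n : nat) (f : 'rV[R]_n -> R)
    (x0 : 'rV[R]_n) :
  analytic_at f x0 -> exists P r B, taylor_expansion f x0 P r B.
Proof.
move=> /analytic_power_series[c [r [B cf]]].
exists (homogeneous_part c), r, B; split.
- by have [r0 /(_ fset0)] := cf; rewrite big_nil.
- exact: homogeneous_part_differentiable.
- exact: homogeneous_partZ.
- by move=> m x; exact: power_series_taylor.
Qed.

(** The terms of degree at most one form a differentiable function and the rest is
quadratic. *)
Lemma analytic_differentiable (R : realType) (n : nat) (f : 'rV[R]_n -> R^o)
    (x0 : 'rV[R]_n) :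
  analytic_at f x0 -> differentiable f x0.
Proof.
move=> /analytic_taylor[P [r [B [[r0 B0] dP _ PB]]]].
pose T : 'rV[R]_n -> R^o := fun y => \sum_(k < 2) P k (y - x0).
have dT : differentiable T x0.
  apply: differentiable_bigsum => k.
  apply: (@differentiable_comp _ _ _ _ (fun y : 'rV[R]_n => y - x0) (P k)) => //.
have -> : f = T + (f - T) by rewrite addrC subrK.
apply: differentiableD => //.
apply: (@quadratic_differentiable _ _ _ _ (B / r ^+ 2)).
near=> h; rewrite !fctE /T.
have -> : x0 + h - x0 = h by rewrite addrAC subrr add0r.
have -> : B / r ^+ 2 * `|h| ^+ 2 = B * (`|h| / r) ^+ 2.
  by rewrite expr_div_n; ring.
apply: PB; near: h; exact: (@nbhs0_le _ 'rV[R]_n).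
Unshelve. all: by end_near. Qed.

Lemma eq0_le_small (R : realType) (a K d : R) :
  0 < d -> (forall t, 0 < t < d -> `|a| <= K * t) -> a = 0.
Proof.
move=> d0 aK; apply/eqP; rewrite -normr_le0; apply/ler_addgt0Pr => e e0.
pose t := Num.min (d / 2) (e / (`|K| + 1)).
have K0 : 0 < `|K| + 1 by rewrite ltr_wpDl.
have t0 : 0 < t by rewrite lt_min !divr_gt0.
have td : t < d by rewrite gt_min ltr_pdivrMr // ltr_pMr // ltr1n.
have /aK/le_trans : 0 < t < d by rewrite t0 td.
apply; rewrite add0r; apply: (@le_trans _ _ ((`|K| + 1) * t)).
  by rewrite ler_wpM2r ?(ltW t0) // (le_trans (ler_norm _)) // lerDl.
by rewrite -ler_pdivlMl // mulrC ge_min lexx orbT.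
Qed.

(** Along the ray of direction [x] the first nonzero term would dominate both the
remainder and the bound on [f]. *)
Lemma taylor_terms_vanish_along (R : realType) (n : nat) (f : 'rV[R]_n -> R)
    (x0 : 'rV[R]_n) P (r B : R) (x : 'rV[R]_n) (m : nat) (C d : R) :
  taylor_expansion f x0 P r B -> 0 < d ->
  (forall t, 0 < t < d -> `|f (x0 + t *: x)| <= C * t ^+ m) ->
  forall k, (k < m)%N -> P k x = 0.
Proof.
move=> [[r0 B0] _ PZ PB] d0 fC; elim/ltn_ind => k IH km.
pose d1 := Num.min (Num.min d 1) (r / (`|x| + 1)).
have x1 : 0 < `|x| + 1 by rewrite ltr_wpDl.
have d10 : 0 < d1 by rewrite !lt_min d0 ltr01 divr_gt0.
apply: (@eq0_le_small _ _ (`|C| + B * (`|x| / r) ^+ k.+1) d1) => // t.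
rewrite !lt_min => /andP[t0 /andP[/andP[td t1] tr]].
have tx : `|t *: x| = t * `|x| by rewrite normrZ gtr0_norm.
have txr : `|t *: x| <= r.
  rewrite tx; apply: (@le_trans _ _ (t * (`|x| + 1))).
    by rewrite ler_pM2l // lerDl.
  by rewrite -ler_pdivlMr // ltW.
have /fC ft : 0 < t < d by rewrite t0 td.
have := PB k.+1 _ txr.
rewrite big_ord_recr /= big1 ?add0r; last first.
  by move=> i _; rewrite PZ IH ?mulr0 // (ltn_trans _ km).
rewrite PZ => Pt.
rewrite -(@ler_pM2l _ (t ^+ k)) ?exprn_gt0 //.
have -> : t ^+ k * `|P k x| = `|t ^+ k * P k x|.
  by rewrite normrM gtr0_norm // exprn_gt0.
have -> : t ^+ k * P k x = f (x0 + t *: x) - (f (x0 + t *: x) - t ^+ k * P k x) by ring.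
apply: le_trans (ler_normB _ _) _.
have -> : t ^+ k * ((`|C| + B * (`|x| / r) ^+ k.+1) * t) =
    `|C| * t ^+ k.+1 + B * (`|t *: x| / r) ^+ k.+1.
  by rewrite tx -(mulrA t); move: (_ / r) => q; rewrite exprMn !exprS; ring.
apply: lerD => //; apply: le_trans ft _.
apply: (@le_trans _ _ (`|C| * t ^+ m)).
  by rewrite ler_wpM2r ?exprn_ge0 ?(ltW t0) // ler_norm.
by rewrite ler_wpM2l // ler_wiXn2l // ltW.
Qed.

Lemma taylor_terms0 (R : realType) (n : nat) (f : 'rV[R]_n -> R)
    (x0 : 'rV[R]_n) P (r B : R) (x : 'rV[R]_n) :
  taylor_expansion f x0 P r B -> (forall k, P k x = 0) -> `|x| < r ->
  f (x0 + x) = 0.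
Proof.
move=> [[r0 B0] _ _ PB] P0 xr.
pose q := `|x| / r.
have q0 : 0 <= q by rewrite divr_ge0 // ltW.
have q1 : `|q| < 1 by rewrite ger0_norm // ltr_pdivrMr // mul1r.
apply/eqP; rewrite -normr_le0.
have qcvg : B * q ^+ m @[m --> \oo] --> B * 0 by apply: cvgMl_tmp; exact: cvg_expr.
rewrite mulr0 in qcvg; rewrite -(cvg_lim _ qcvg) //; apply: limr_ge; first exact: cvgP qcvg.
near=> m; have := PB m _ (ltW xr).
by rewrite big1 ?subr0 // => i _; exact: P0.
Unshelve. all: by end_near. Qed.

(** * Term-by-term differentiation *)

(** Second-order Taylor estimate of a power.  The factor [2 ^ m.+1] absorbs the
binomial coefficient [m.+1 * m / 2]; it is paid for later by halving the radius. *)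
Lemma expr_second_order (R : realType) (a b p : R) (m : nat) :
  `|a| <= p -> `|b| <= p ->
  p ^+ 2 * `|b ^+ m.+1 - a ^+ m.+1 - m.+1%:R * (b - a) * a ^+ m|
    <= (2 * p) ^+ m.+1 * (b - a) ^+ 2.
Proof.
move=> ap bp; have p0 : 0 <= p by apply: le_trans ap.
elim: m => [|m IH].
  have -> : b ^+ 1 - a ^+ 1 - 1%:R * (b - a) * a ^+ 0 = 0.
    by rewrite !expr1 expr0; ring.
  by rewrite normr0 mulr0 mulr_ge0 ?sqr_ge0 // exprn_ge0 // mulr_ge0.
set e := _ - _ - _ in IH.
have -> : b ^+ m.+2 - a ^+ m.+2 - m.+2%:R * (b - a) * a ^+ m.+1 =
    b * e + m.+1%:R * a ^+ m * (b - a) ^+ 2.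
  by rewrite /e -[m.+2%:R]natr1 !exprS; ring.
apply: (@le_trans _ _ (p ^+ 2 * (p * `|e| + m.+1%:R * p ^+ m * (b - a) ^+ 2))).
  rewrite ler_wpM2l ?exprn_ge0 //; apply: le_trans (ler_normD _ _) _.
  rewrite (normrM b e) (normrM _ ((b - a) ^+ 2)) (ger0_norm (sqr_ge0 _)).
  rewrite (normrM _ (a ^+ m)) normr_nat normrX; apply: lerD.
    exact: ler_wpM2r.
  rewrite ler_wpM2r ?sqr_ge0 // ler_wpM2l //.
  by apply: lerXn2r; rewrite ?nnegrE.
have -> : p ^+ 2 * (p * `|e| + m.+1%:R * p ^+ m * (b - a) ^+ 2) =
   p * (p ^+ 2 * `|e|) + p ^+ m.+2 * (b - a) ^+ 2 * m.+1%:R.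
  by rewrite !exprS; ring.
have -> : (2 * p) ^+ m.+2 * (b - a) ^+ 2 =
   p * ((2 * p) ^+ m.+1 * (b - a) ^+ 2) + p ^+ m.+2 * (b - a) ^+ 2 * 2 ^+ m.+1.
  by rewrite !exprMn !exprS; ring.
apply: lerD; first exact: ler_wpM2l.
apply: ler_wpM2l; first by apply: mulr_ge0; rewrite ?sqr_ge0 ?exprn_ge0.
by rewrite -natrX ler_nat ltnW // ltn_expl.
Qed.

(** Multiplication of a monomial by the [j]-th variable. *)
Definition raise_index (n : nat) (j : 'I_n) (a : multi_index n) : multi_index n :=
  [ffun i => (a i + (i == j))%N].

(** Left inverse of [raise_index]; the truncated subtraction only matters on
indices whose [j]-th entry is zero. *)
Definition lower_index (n : nat) (j : 'I_n) (a : multi_index n) : multi_index n :=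
  [ffun i => (a i - (i == j))%N].

Lemma raise_indexK n (j : 'I_n) : cancel (raise_index j) (lower_index j).
Proof. by move=> a; apply/ffunP => i; rewrite !ffunE addnK. Qed.

Lemma lower_indexK n (j : 'I_n) (a : multi_index n) :
  (0 < a j)%N -> raise_index j (lower_index j a) = a.
Proof.
by move=> aj; apply/ffunP => i; rewrite !ffunE subnK //; case: eqP => // ->.
Qed.

Lemma mdeg_raise n (j : 'I_n) (a : multi_index n) :
  mdeg (raise_index j a) = (mdeg a).+1.
Proof.
rewrite /mdeg (eq_bigr (fun i => a i + (i == j))%N); last by move=> i; rewrite ffunE.
rewrite big_split /= -addn1; congr addn.
by rewrite (bigD1 j) //= eqxx big1 // => i /negbTE ->.
Qed.

Lemma monomialE (R : realType) (n : nat) (j : 'I_n) (a : multi_index n)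
    (x : 'rV[R]_n) :
  monomial a x = x 0 j ^+ a j * \prod_(i < n | i != j) x 0 i ^+ a i.
Proof. by rewrite /monomial (bigD1 j). Qed.

Lemma monomial_shift (R : realType) (n : nat) (j : 'I_n) (a : multi_index n)
    (x : 'rV[R]_n) (h : R) :
  monomial a (x + h *: delta_mx 0 j) =
  (x 0 j + h) ^+ a j * \prod_(i < n | i != j) x 0 i ^+ a i.
Proof.
rewrite (monomialE j) !mxE !eqxx mulr1; congr (_ * _).
by apply: eq_bigr => i /negbTE ij; rewrite !mxE ij andbF mulr0 addr0.
Qed.

(** Only the [j]-th variable moves, so the one-variable estimate applies; the
other factors are bounded by powers of [2 * p]. *)
Lemma monomial_shift_raise (R : realType) (n : nat) (j : 'I_n) (a : multi_index n)
    (x : 'rV[R]_n) (h p : R) :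
  `|x| <= p -> `|x + h *: delta_mx 0 j| <= p ->
  p ^+ 2 * `|monomial (raise_index j a) (x + h *: delta_mx 0 j)
             - monomial (raise_index j a) x - h * ((a j).+1%:R * monomial a x)|
    <= (2 * p) ^+ (mdeg a).+1 * h ^+ 2.
Proof.
move=> xp xhp.
have p0 : 0 <= p by apply: le_trans xp.
have xj : `|x 0 j| <= p by apply: le_trans xp; exact: norm_coord.
have xhj : `|x 0 j + h| <= p.
  by apply: le_trans xhp; have := norm_coord (x + h *: delta_mx 0 j) j;
     rewrite !mxE !eqxx mulr1.
rewrite monomial_shift !(monomialE j).
have -> : raise_index j a j = (a j).+1 by rewrite ffunE eqxx addn1.
have -> : \prod_(i < n | i != j) x 0 i ^+ raise_index j a i
        = \prod_(i < n | i != j) x 0 i ^+ a i.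
  by apply: eq_bigr => i /negbTE ij; rewrite ffunE ij addn0.
set q := \prod_(_ < _ | _) _.
have := expr_second_order (a j) xj xhj.
have -> : x 0 j + h - x 0 j = h by ring.
set e := (_ - _ - _) => eb.
have -> : (x 0 j + h) ^+ (a j).+1 * q - x 0 j ^+ (a j).+1 * q
   - h * ((a j).+1%:R * (x 0 j ^+ a j * q)) = e * q by rewrite /e; ring.
have qb : `|q| <= (2 * p) ^+ (\sum_(i < n | i != j) a i)%N.
  rewrite /q normr_prod expr_sum; apply: ler_prod => i _.
  rewrite normr_ge0 normrX /=; apply: lerXn2r; rewrite ?nnegrE ?mulr_ge0 //.
  apply: le_trans (norm_coord _ _) _; apply: le_trans xp _.
  by rewrite ler_peMl // ler1n.
rewrite normrM mulrA.
have -> : (mdeg a).+1 = ((a j).+1 + \sum_(i < n | i != j) a i)%N.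
  by rewrite /mdeg (bigD1 j) //= addSn.
rewrite exprD [leRHS]mulrAC; apply: ler_pM => //.
by rewrite mulr_ge0 // exprn_ge0.
Qed.


(** Coefficients of the formal partial derivative along the [j]-th variable. *)
Definition derived_series (R : realType) (n : nat) (j : 'I_n)
    (c : multi_index n -> R) (a : multi_index n) : R :=
  (a j).+1%:R * c (raise_index j a).

(** A formal derivative only sees the indices with a positive [j]-th entry, which
are the raised ones.  The extra set [U] makes the left-hand index set as large
as convergence of the original series requires. *)
Lemma sum_raise_index (R : realType) (n : nat) (j : 'I_n)
    (g : multi_index n -> R) (U A : {fset multi_index n}) :
  (forall a : multi_index n, a j = 0%N -> g a = 0) ->
  (lower_index j @` U `<=` A)%fset ->
  \sum_(a <- ((raise_index j @` A) `|` U)%fset) g a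
    = \sum_(a <- A) g (raise_index j a).
Proof.
move=> g0 UA; rewrite sum_fsetU [X in _ + X]big_seq_cond [X in _ + X]big1 ?addr0; last first.
  move=> a /andP[aU aA]; apply: g0; apply/eqP; apply: contraNT aA.
  rewrite -lt0n => aj; apply/imfsetP; exists (lower_index j a).
    by apply: (fsubsetP UA); apply/imfsetP; exists a.
  by rewrite lower_indexK.
rewrite big_imfset //= => a b _ _; exact: (can_inj (@raise_indexK n j)).
Qed.

(** For a step [h] fixed in advance, three quantities are compared: the derivative
with the difference quotient, the difference quotient with the finite sums of
quotients of monomials, and those with the finite sums of the derived series.
The first is small by differentiability, the second for large index sets, the
third is at most [h] times the constant [K], uniformly in the index set. *)
Lemma derived_series_cvg (R : realType) (n : nat) (f : 'rV[R]_n -> R^o)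
    (x0 x : 'rV[R]_n) (j : 'I_n) c (r B : R) :
  power_series f x0 c r B -> `|x| < r / 4 ->
  derivable f (x0 + x) (delta_mx 0 j) ->
  summability.partial_sum (fun a => derived_series j c a * monomial a x)
    @ summability.totally --> 'D_(delta_mx 0 j) f (x0 + x).
Proof.
move=> [r0 cB cf] xr; set v := delta_mx 0 j => df; set D := derive f _ _.
have B0 : 0 <= B by have := cB fset0; rewrite big_nil.
apply/totally_cvgP => e e0.
pose p := r / 2; have p0 : 0 < p by rewrite divr_gt0.
pose K := B / p ^+ 2 + 1; have K0 : 0 < K.
  by rewrite ltr_wpDl // divr_ge0 // exprn_ge0 // ltW.
have /cvgrPdist_le /(_ (e / 3)) : h^-1 *: (f (h *: v + (x0 + x)) - f (x0 + x))
    @[h --> 0^'] --> D by exact: df.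
rewrite divr_gt0 // => /(_ isT) /nbhs_ballP[d /= d0 dD].
(* [d] serves the difference quotient, [r / 4] keeps the shifted point in the
   polydisc, and the last bound makes the quadratic error at most [h * (e / 3)]. *)
pose h := Num.min (d / 2) (Num.min (r / 4) (e / (3 * K))).
have h0 : 0 < h by rewrite !lt_min !divr_gt0 // mulr_gt0.
have hd : h < d by rewrite gt_min ltr_pdivrMr // ltr_pMr // ltr1n.
have hr : h <= r / 4 by rewrite !ge_min lexx orbT.
have hK : h * K <= e / 3.
  have : h <= e / (3 * K) by rewrite !ge_min lexx !orbT.
  by rewrite !ler_pdivlMr ?mulr_gt0 // (mulrC 3) mulrA.
have {dD} quot : `|h * D - (f (x0 + x + h *: v) - f (x0 + x))| <= h * (e / 3).
  have := dD h; rewrite -ball_normE /= add0r normrN gtr0_norm // gt_eqF //.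
  move=> /(_ hd isT); rewrite (addrC (h *: v)) => qD.
  set F1 := f _ - f _ in qD *.
  have -> : h * D - F1 = h * (D - h^-1 *: F1).
    by rewrite mulrBr -[h^-1 *: F1]/(h^-1 * F1) mulVKf // gt_eqF.
  by rewrite normrM gtr0_norm // ler_pM2l.
have rp : r = p + p by rewrite /p; field.
have r4 : r / 4 + r / 4 = p by rewrite /p; field.
have xp : `|x| <= p by apply: ltW; apply: lt_trans xr _; rewrite -r4 ltrDl divr_gt0.
have nv : `|v| <= 1.
  apply: norm_row_le => // i; rewrite mxE eqxx /=.
  by case: (_ == _); rewrite ?normr1 ?normr0.
have xhp : `|x + h *: v| <= p.
  apply: le_trans (ler_normD _ _) _; rewrite -r4; apply: lerD; first exact: ltW.
  by rewrite normrZ gtr0_norm // (le_trans _ hr) // ler_piMr // ltW.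
have pr : p <= r by rewrite rp lerDl ltW.
have he6 : 0 < h * (e / 6) by rewrite mulr_gt0 // divr_gt0.
have [U1 U1P] := (totally_cvgP _ _).1 (cf _ (le_trans xhp pr)) _ he6.
have [U2 U2P] := (totally_cvgP _ _).1 (cf _ (le_trans xp pr)) _ he6.
exists (lower_index j @` (U1 `|` U2))%fset => A UA.
pose g a := c a * (monomial a (x + h *: v) - monomial a x).
have g0 (a : multi_index n) : a j = 0%N -> g a = 0.
  by move=> aj; rewrite /g monomial_shift (monomialE j) aj !expr0 subrr mulr0.
have := sum_raise_index g0 UA; set A' := (_ `|` _)%fset => gA.
have U1A : (U1 `<=` A')%fset.
  by rewrite /A' fsetUA fsetUAC fsubsetUr.
have U2A : (U2 `<=` A')%fset by rewrite /A' fsetUA fsubsetUr.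
have fg : `|f (x0 + x + h *: v) - f (x0 + x) - \sum_(a <- A) g (raise_index j a)|
    <= h * (e / 3).
  rewrite -gA /g.
  rewrite (eq_bigr (fun a => c a * monomial a (x + h *: v) - c a * monomial a x));
    last by move=> a _; rewrite mulrBr.
  rewrite sumrB.
  have -> : e / 3 = e / 6 + e / 6 by field.
  have := U1P _ U1A; have := U2P _ U2A; rewrite addrA.
  set s1 := \sum_(_ <- _) _; set s2 := \sum_(_ <- _) _ => b1 b2.
  have -> : f (x0 + x + h *: v) - f (x0 + x) - (s2 - s1) =
     (f (x0 + x + h *: v) - s2) - (f (x0 + x) - s1) by ring.
  by rewrite mulrDr; apply: le_trans (ler_normB _ _) _; apply: lerD.
pose S := \sum_(a <- A) derived_series j c a * monomial a x.
have gS : `|\sum_(a <- A) g (raise_index j a) - h * S| <= h * (h * K).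
  rewrite /S mulr_sumr -sumrB.
  apply: (@le_trans _ _ (\sum_(a <- A)
    `|c (raise_index j a)| * r ^+ mdeg (raise_index j a) * (h ^+ 2 / p ^+ 2))).
    apply: le_trans (ler_norm_sum _ _ _) _; apply: ler_sum => a _.
    have := monomial_shift_raise a xp xhp; rewrite -(mdeg_raise j).
    have -> : 2 * p = r by rewrite rp; ring.
    set E := _ - _ - _ => Eb.
    have -> : g (raise_index j a) - h * (derived_series j c a * monomial a x) =
      c (raise_index j a) * E by rewrite /g /derived_series /E; ring.
    rewrite normrM -mulrA ler_wpM2l // mulrA ler_pdivlMr ?exprn_gt0 //.
    by rewrite mulrC.
  rewrite -mulr_suml.
  have -> : h * (h * K) = B * (h ^+ 2 / p ^+ 2) + h ^+ 2.
    by rewrite /K expr2; field; rewrite gt_eqF.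
  rewrite -[leLHS]addr0; apply: lerD; last exact: sqr_ge0.
  rewrite ler_wpM2r ?divr_ge0 ?sqr_ge0 //.
  have := cB (raise_index j @` A)%fset; rewrite big_imfset //= => a b _ _.
  exact: (can_inj (@raise_indexK n j)).
rewrite -(@ler_pM2l _ h) //.
have -> : h * `|D - S| = `|h * (D - S)| by rewrite normrM gtr0_norm.
set F1 := f (x0 + x + h *: v) - f (x0 + x) in quot fg *.
set G := \sum_(a <- A) g _ in fg gS.
have -> : h * (D - S) = (h * D - F1) + (F1 - G) + (G - h * S) by ring.
have -> : h * e = h * (e / 3) + h * (e / 3) + h * (e / 3) by field.
apply: le_trans (ler_normD _ _) _; apply: lerD.
  by apply: le_trans (ler_normD _ _) _; apply: lerD.
by apply: le_trans gS _; rewrite ler_pM2l.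
Qed.

Lemma power_series_derive (R : realType) (n : nat) (f : 'rV[R]_n -> R^o)
    (x0 : 'rV[R]_n) (j : 'I_n) c (r B : R) :
  (forall x, analytic_at f x) -> power_series f x0 c r B ->
  exists r' B',
    power_series ('D_(delta_mx 0 j) f) x0 (derived_series j c) r' B'.
Proof.
move=> fan cf; have [r0 _ _] := cf.
apply: near_power_series; apply/nbhs_ballP; exists (r / 4).
  by rewrite /= divr_gt0.
move=> y; rewrite -ball_normE /= => yr.
have y0 : x0 + (y - x0) = y by rewrite addrCA subrr addr0.
have := @derived_series_cvg _ _ _ _ (y - x0) j _ _ _ cf; rewrite y0; apply.
  by rewrite distrC.
exact/diff_derivable/analytic_differentiable.
Qed.

Lemma analytic_derive (R : realType) (n : nat) (f : 'rV[R]_n -> R^o) (j : 'I_n) :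
  (forall x, analytic_at f x) ->
  forall x, analytic_at ('D_(delta_mx 0 j) f) x.
Proof.
move=> fan x0; have [c [r [B cf]]] := analytic_power_series (fan x0).
have [r' [B' cf']] := power_series_derive j fan cf.
exact: power_series_analytic cf'.
Qed.

(** Both sides are the sum at the centre of one and the same twice derived series. *)
Lemma analytic_derive_comm (R : realType) (n : nat) (f : 'rV[R]_n -> R^o)
    (i j : 'I_n) (x : 'rV[R]_n) :
  (forall x, analytic_at f x) ->
  'D_(delta_mx 0 i) ('D_(delta_mx 0 j) f) x
    = 'D_(delta_mx 0 j) ('D_(delta_mx 0 i) f) x.
Proof.
move=> fan; have [c [r [B cf]]] := analytic_power_series (fan x).
have value k l : summability.partial_sum (fun a =>
      derived_series k (derived_series l c) a * monomial a (0 : 'rV[R]_n))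
      @ summability.totally
    --> 'D_(delta_mx 0 k) ('D_(delta_mx 0 l) f) x.
  have [r' [B' lf]] := power_series_derive l fan cf.
  have [r'' [B'' [r0 _ /(_ 0)]]] := power_series_derive k (analytic_derive l fan) lf.
  by rewrite normr0 addr0; apply; exact: ltW.
have FF := @summability.totally_filter {ffun 'I_n -> nat}.
suff cE : derived_series j (derived_series i c) =
          derived_series i (derived_series j c).
  by have vji := value j i; rewrite cE in vji; exact: (cvg_unique _ (value i j) vji).
apply/funext => a; rewrite /derived_series.
have -> : raise_index i (raise_index j a) = raise_index j (raise_index i a).
  by apply/ffunP => k; rewrite !ffunE addnAC.
have [-> //|ij] := eqVneq i j.
by rewrite !ffunE (negbTE ij) eq_sym (negbTE ij) !addn0 mulrCA.
Qed.

(** * Linear combinations and the mean value theorem on segments *)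

Lemma analytic_at_lincomb (R : realType) (n : nat) (f g : 'rV[R]_n -> R) (a : R)
    (x : 'rV[R]_n) :
  analytic_at f x -> analytic_at g x -> analytic_at (fun y => f y + a * g y) x.
Proof.
move=> [cf fP] [cg gP]; exists (fun i => cf i + a * cg i).
have FF := @summability.totally_filter {ffun 'I_n -> nat}.
near=> y.
have fy : summability.partial_sum (fun i => cf i * \prod_(j < n) (y - x) 0 j ^+ i j)
    @ summability.totally --> f y by near: y.
have gy : summability.partial_sum (fun i => cg i * \prod_(j < n) (y - x) 0 j ^+ i j)
    @ summability.totally --> g y by near: y.
rewrite (_ : summability.partial_sum _ =
   fun A => summability.partial_sum
              (fun i => cf i * \prod_(j < n) (y - x) 0 j ^+ i j) A +
     a * summability.partial_sum
              (fun i => cg i * \prod_(j < n) (y - x) 0 j ^+ i j) A).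
  exact: cvgD fy (cvgMl_tmp (a := a) gy).
apply/funext => A; rewrite !partial_sumE mulr_sumr -big_split /=.
by apply: eq_bigr => i _; rewrite mulrDl mulrA.
Unshelve. all: by end_near. Qed.

Lemma analytic_at0 (R : realType) (n : nat) (x : 'rV[R]_n) :
  analytic_at (fun=> 0) x.
Proof.
exists (fun=> 0); near=> y.
apply/totally_cvgP => e e0; exists fset0 => A _.
by rewrite big1 ?subr0 ?normr0 ?ltW // => i _; rewrite mul0r.
Unshelve. all: by end_near. Qed.

Lemma analytic_at_sum (R : realType) (n : nat) (I : Type) (s : seq I)
    (a : I -> R) (f : I -> 'rV[R]_n -> R) (x : 'rV[R]_n) :
  (forall i, analytic_at (f i) x) ->
  analytic_at (fun y => \sum_(i <- s) a i * f i y) x.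
Proof.
move=> fan; elim: s => [|i s IH].
  rewrite (_ : (fun _ => _) = fun=> 0); first exact: analytic_at0.
  by apply/funext => y; rewrite big_nil.
rewrite (_ : (fun _ => _) = fun y => \sum_(i <- s) a i * f i y + a i * f i y).
  exact: analytic_at_lincomb.
by apply/funext => y; rewrite big_cons addrC.
Qed.

Lemma derive_sum_coord (R : realType) (n : nat) (f : 'rV[R]_n -> R^o)
    (x v : 'rV[R]_n) :
  differentiable f x ->
  'D_v f x = \sum_j v 0 j * 'D_(delta_mx 0 j) f x.
Proof.
move=> df; rewrite deriveE // {1}[v]row_sum_delta linear_sum /=.
by apply: eq_bigr => j _; rewrite linearZ deriveE.
Qed.

Lemma mvt_line (R : realType) (n : nat) (f : 'rV[R]_n -> R^o) (x v : 'rV[R]_n) :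
  (forall y, differentiable f y) ->
  exists2 s : R, 0 <= s <= 1 & f (x + v) - f x = 'D_v f (x + s *: v).
Proof.
move=> df; pose g (s : R) : R^o := f (x + s *: v).
have gE s : is_derive (s : R^o) (1 : R^o) g ('D_v f (x + s *: v)).
  have dg : differentiable g s.
    apply: (@differentiable_comp _ _ _ _ (fun s : R => x + s *: v) f) => //.
  have <- : 'D_1 g s = 'D_v f (x + s *: v).
    rewrite /derive; set d := (fun _ : R => _); set d' := (fun _ : R => _).
    suff -> : d = d' by []; apply/funext => h; rewrite /d /d' /=.
    rewrite /g [h *: (1 : R^o)](mulr1 h) scalerDl.
    by congr (_ *: (f _ - _)); rewrite addrCA.
  exact/derivableP/diff_derivable.
have cg : {within `[0, 1], continuous g}.
  by apply: derivable_within_continuous => s _; have [] := gE s.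
have [s s01] := @MVT_segment R g (fun s => 'D_v f (x + s *: v)) 0 1 ler01
  (fun s _ => gE s) cg.
rewrite subr0 mulr1 /g scale1r scale0r addr0 => fE; exists s => //.
Qed.

(** * Order of vanishing *)

(** [f (p + x) = O(|x| ^ m)] as [x] tends to [0]. *)
Definition vanishing (R : realType) (n : nat) (f : 'rV[R]_n -> R)
    (p : 'rV[R]_n) (m : nat) : Prop :=
  exists C d, [/\ 0 <= C, 0 < d &
    forall x, `|x| <= d -> `|f (p + x)| <= C * `|x| ^+ m].

(** Together with [terms_vanishing]: an analytic function vanishes to order [m]
exactly if its homogeneous parts below degree [m] are zero. *)
Lemma vanishing_terms (R : realType) (n : nat) (f : 'rV[R]_n -> R)
    (p : 'rV[R]_n) P (r B : R) (m : nat) :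
  taylor_expansion f p P r B -> vanishing f p m ->
  forall k x, (k < m)%N -> P k x = 0.
Proof.
move=> fP [C [d [C0 d0 fC]]] k x km.
have x1 : 0 < `|x| + 1 by rewrite ltr_wpDl.
apply: (@taylor_terms_vanish_along _ _ _ _ _ _ _ _ m (C * `|x| ^+ m)
   (d / (`|x| + 1)) fP _ _ _ km); first by rewrite divr_gt0.
move=> t /andP[t0]; rewrite ltr_pdivlMr // => tx.
have tE : `|t *: x| = t * `|x| by rewrite normrZ gtr0_norm.
apply: le_trans (fC _ _) _; last by rewrite tE exprMn; lra.
by rewrite tE; apply: le_trans (ltW tx); rewrite ler_pM2l // lerDl.
Qed.

Lemma terms_vanishing (R : realType) (n : nat) (f : 'rV[R]_n -> R)
    (p : 'rV[R]_n) P (r B : R) (m : nat) :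
  taylor_expansion f p P r B -> (forall k x, (k < m)%N -> P k x = 0) ->
  vanishing f p m.
Proof.
move=> [[r0 B0] _ _ PB] P0; exists (B / r ^+ m), r; split=> //.
  by rewrite divr_ge0 // exprn_ge0 // ltW.
move=> x xr; have := PB m x xr; rewrite big1 ?subr0; last first.
  by move=> i _; rewrite P0.
by rewrite expr_div_n; lra.
Qed.

Lemma taylor_leading_bound (R : realType) (n : nat) (f : 'rV[R]_n -> R)
    (p : 'rV[R]_n) P (r B : R) (m : nat) (x : 'rV[R]_n) :
  taylor_expansion f p P r B -> (forall k x, (k < m)%N -> P k x = 0) ->
  `|x| <= r -> `|f (p + x) - P m x| <= B * (`|x| / r) ^+ m.+1.
Proof.
move=> [_ _ _ PB] P0 xr; have := PB m.+1 x xr.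
by rewrite big_ord_recr /= big1 ?add0r // => i _; rewrite P0.
Qed.

(** All homogeneous parts are zero, and the geometric remainder tends to zero. *)
Lemma vanishing_analytic_eq0 (R : realType) (n : nat) (f : 'rV[R]_n -> R)
    (p : 'rV[R]_n) :
  analytic_at f p -> (forall m, vanishing f p m) ->
  exists2 d, 0 < d & forall x, `|x| < d -> f (p + x) = 0.
Proof.
move=> /analytic_taylor[P [r [B fP]]] fv.
exists r; first by case: fP => -[].
by move=> x; apply: (taylor_terms0 fP) => k; exact: (vanishing_terms fP (fv k.+1)).
Qed.

(** Suppose the first nonzero homogeneous part [Q l] of the derivative had [l < m].
It stays away from zero on a short segment from [x] in the direction [e].  On
the contracted segment at [p + t *: x] the mean value theorem makes the
derivative [O(t ^ m)], since [f] is [O(t ^ m.+1)] and the length of the segment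
is of order [t]; but the derivative is also [t ^ l * Q l] up to
[O(t ^ l.+1)]. *)
Lemma vanishing_derive (R : realType) (n : nat) (f : 'rV[R]_n -> R^o)
    (p : 'rV[R]_n) (m : nat) (j : 'I_n) :
  (forall x, analytic_at f x) -> vanishing f p m.+1 ->
  vanishing ('D_(delta_mx 0 j) f) p m.
Proof.
move=> fan [C [d [C0 d0 fC]]].
set e := delta_mx 0 j; set g := derive f ^~ e.
have df y : differentiable f y by exact: analytic_differentiable.
have [Q [r [B gQ]]] := analytic_taylor (analytic_derive j fan p).
have [[r0 B0] dQ QZ _] := gQ.
apply: (terms_vanishing gQ) => l x; move: x; elim/ltn_ind: l => l IH x lm.
apply/eqP; apply: contraT => Qx.
pose c := `|Q l x| / 2; have c0 : 0 < c by rewrite divr_gt0 // normr_gt0.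
have ne : `|e| <= 1.
  apply: norm_row_le => // i; rewrite mxE eqxx /=.
  by case: (_ == _); rewrite ?normr1 ?normr0.
have /cvgrPdist_lt /(_ c c0) : Q l y @[y --> x] --> Q l x.
  exact: differentiable_continuous (dQ l x).
move=> /nbhs_ballP[s0 /= s00 xs0].
(* [s1] is the length of a segment on which [|Q l| >= c]; it is independent of
   the contraction factor [t] chosen below. *)
pose s1 := Num.min (s0 / 2) 1.
have s10 : 0 < s1 by rewrite lt_min divr_gt0 //=.
have s1s0 : s1 < s0 by rewrite gt_min ltr_pdivrMr // ltr_pMr // ltr1n.
have s11 : s1 <= 1 by rewrite ge_min lexx orbT.
pose N := `|x| + 1; have N0 : 0 < N by rewrite ltr_wpDl.
have sN s : 0 <= s <= 1 -> `|s *: (s1 *: e)| <= s1.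
  move=> /andP[s_ge0 s_le1]; rewrite !normrZ (ger0_norm s_ge0) gtr0_norm //.
  by rewrite mulrA -[leRHS]mulr1; apply: ler_pM; rewrite ?mulr_ge0 ?(ltW s10) //;
     rewrite ler_piMl // ltW.
have yN s : 0 <= s <= 1 -> `|x + s *: (s1 *: e)| <= N.
  move=> s01; apply: le_trans (ler_normD _ _) _; rewrite lerD2l.
  exact: le_trans (sN s s01) s11.
have cQ s : 0 <= s <= 1 -> c <= `|Q l (x + s *: (s1 *: e))|.
  move=> s01; have := xs0 (x + s *: (s1 *: e)); rewrite -ball_normE /=.
  rewrite opprD addrA subrr add0r normrN => /(_ (le_lt_trans (sN s s01) s1s0)) Qd.
  have : `|Q l x| <= `|Q l x - Q l (x + s *: (s1 *: e))| + `|Q l (x + s *: (s1 *: e))|.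
    by apply: le_trans (ler_normD _ _); rewrite subrK.
  by rewrite /c in Qd *; lra.
pose K := 2 * C * N ^+ m.+1 / s1 + B * (N / r) ^+ l.+1.
suff c_eq0 : c = 0 by rewrite c_eq0 ltxx in c0.
pose t0 := Num.min 1 (Num.min (d / N) (r / N)).
apply: (@eq0_le_small _ _ K t0); first by rewrite !lt_min ltr01 !divr_gt0.
move=> t; rewrite !lt_min => /andP[t_gt0 /and3P[t1 td tr]].
rewrite ltr_pdivlMr // in td; rewrite ltr_pdivlMr // in tr.
have tyN (y : 'rV[R]_n) : `|y| <= N -> `|t *: y| <= t * N.
  by move=> yb; rewrite normrZ gtr0_norm // ler_pM2l.
have [s s01] := mvt_line (p + t *: x) (t *: (s1 *: e)) df.
set y := x + s *: (s1 *: e).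
have -> : p + t *: x + s *: (t *: (s1 *: e)) = p + t *: y.
  by rewrite /y scalerDr addrA !scalerA (mulrC s t).
have -> : 'D_(t *: (s1 *: e)) f (p + t *: y) = t * s1 * g (p + t *: y).
  by rewrite scalerA !deriveE // linearZ /g deriveE.
rewrite -addrA -scalerDr => fg.
have yb : `|y| <= N by exact: yN.
have fb (z : 'rV[R]_n) : `|z| <= N -> `|f (p + t *: z)| <= C * (t * N) ^+ m.+1.
  move=> zN; have tzd := le_trans (tyN z zN) (ltW td).
  apply: le_trans (fC _ tzd) _; rewrite ler_wpM2l //.
  by apply: lerXn2r; rewrite ?nnegrE ?mulr_ge0 ?(ltW t_gt0) ?(ltW N0) // tyN.
have gb : `|g (p + t *: y)| <= t ^+ m * (2 * C * N ^+ m.+1 / s1).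
  rewrite -(@ler_pM2l _ (t * s1)) ?mulr_gt0 //.
  have -> : t * s1 * `|g (p + t *: y)| = `|t * s1 * g (p + t *: y)|.
    by rewrite [RHS]normrM (gtr0_norm (mulr_gt0 t_gt0 s10)).
  rewrite -fg; apply: le_trans (ler_normB _ _) _.
  have -> : t * s1 * (t ^+ m * (2 * C * N ^+ m.+1 / s1)) =
      C * (t * N) ^+ m.+1 + C * (t * N) ^+ m.+1.
    by rewrite exprMn !exprS; field; rewrite gt_eqF.
  apply: lerD; apply: fb; last by rewrite lerDl.
  by have := yN 1; rewrite scale1r; apply; rewrite ler01 lexx.
have := taylor_leading_bound gQ (fun k x kl => IH k kl x (ltn_trans kl lm))
  (le_trans (tyN y yb) (ltW tr)).
rewrite QZ => gt.
rewrite -(@ler_pM2l _ (t ^+ l)) ?exprn_gt0 //.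
apply: (@le_trans _ _ `|t ^+ l * Q l y|).
  have tl : 0 < t ^+ l by rewrite exprn_gt0.
  by rewrite (gtr0_norm c0) normrM (gtr0_norm tl) ler_pM2l //; exact: cQ.
have -> : t ^+ l * Q l y = g (p + t *: y) - (g (p + t *: y) - t ^+ l * Q l y) by ring.
apply: le_trans (ler_normB _ _) _.
have -> : t ^+ l * (K * t) =
    t ^+ l.+1 * (2 * C * N ^+ m.+1 / s1) + B * (t * N / r) ^+ l.+1.
  by rewrite /K -(mulrA t); move: (N / r) => q; rewrite exprMn !exprS; ring.
apply: lerD.
  apply: le_trans gb _; rewrite ler_wpM2r ?divr_ge0 ?mulr_ge0 ?exprn_ge0 ?(ltW N0) ?(ltW s10) //.
  by rewrite ler_wiXn2l // ltW.
apply: le_trans gt _; rewrite ler_wpM2l //.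
have trN : `|t *: y| / r <= t * N / r by rewrite ler_pM2r ?invr_gt0 // tyN.
by apply: lerXn2r; rewrite ?nnegrE ?divr_ge0 ?mulr_ge0 ?(ltW t_gt0) ?(ltW N0) ?(ltW r0).
Qed.

(** On the curve [c t = p + t *: w t] with [w t] tending to [v], the expansion of
[f (c t) = 0] reads [t ^ k * P k (w t) = O(t ^ k.+1)]. *)
Lemma taylor_leading_curve (R : realType) (n : nat) (f : 'rV[R]_n -> R)
    (p v : 'rV[R]_n) P (r B : R) (k : nat) (c : R -> 'rV[R]_n) :
  taylor_expansion f p P r B -> (forall l x, (l < k)%N -> P l x = 0) ->
  c 0 = p -> (\forall t \near (0 : R), f (c t) = 0) ->
  is_derive (0 : R^o) (1 : R^o) c v -> P k v = 0.
Proof.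
move=> fP P0 c0 fc [dc cv].
have [[r0 B0] dP PZ _] := fP.
pose w t := t^-1 *: (c t - p).
have wv : w t @[t --> 0^'] --> v.
  have := dc; rewrite -cv /w /derivable /derive c0.
  set u := (fun _ : R => _); set u' := (fun _ : R => _).
  have -> // : u = u'.
  by apply/funext => t; rewrite /u /u' /= addr0 [t *: (1 : R^o)](mulr1 t).
have Pw : P k (w t) @[t --> 0^'] --> P k v.
  by apply: cvg_comp wv _; exact: differentiable_continuous (dP k v).
have Pw0 : P k (w t) @[t --> 0^'] --> (0 : R^o).
  pose N := `|v| + 1; have N0 : 0 < N by rewrite ltr_wpDl.
  pose K := B * (N / r) ^+ k.+1.
  have K0 : 0 <= K by rewrite mulr_ge0 // exprn_ge0 // divr_ge0 // ltW.
  apply/cvgr0Pnorm_le => e e0; near=> t.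
  have t0 : t != 0 by near: t; exact: nbhs_dnbhs_neq.
  have wN : `|w t| <= N.
    near: t; apply: (@cvgr_norm_le _ _ _ _ _ _ v) => //; by rewrite /N ltrDl.
  have tr : `|t| <= r / N by near: t; apply: dnbhs0_le; rewrite divr_gt0.
  have te : `|t| <= e / (K + 1) by near: t; apply: dnbhs0_le; rewrite divr_gt0 // ltr_wpDl.
  have fct : f (c t) = 0 by near: t; exact: nbhs_dnbhs.
  have ctE : c t = p + t *: w t.
    by rewrite /w scalerA divff // scale1r addrCA subrr addr0.
  have tw : `|t *: w t| <= `|t| * N by rewrite normrZ ler_wpM2l.
  have twr : `|t *: w t| <= r by apply: le_trans tw _; rewrite -ler_pdivlMr.
  have := taylor_leading_bound fP P0 twr; rewrite -ctE fct sub0r normrN PZ normrM.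
  rewrite normrX => tP.
  have tk0 : 0 < `|t| ^+ k by rewrite exprn_gt0 // normr_gt0.
  rewrite -(@ler_pM2l _ (`|t| ^+ k)) //; apply: le_trans tP _.
  apply: (@le_trans _ _ (B * (`|t| * N / r) ^+ k.+1)).
    rewrite ler_wpM2l //; apply: lerXn2r; rewrite ?nnegrE ?divr_ge0 ?mulr_ge0 ?(ltW N0) ?(ltW r0) //.
    by rewrite ler_pM2r // invr_gt0.
  have -> : B * (`|t| * N / r) ^+ k.+1 = `|t| ^+ k * (K * `|t|).
    by rewrite /K -(mulrA `|t|); move: (N / r) => q; rewrite exprMn !exprS; ring.
  rewrite ler_pM2l //; apply: (@le_trans _ _ ((K + 1) * `|t|)).
    by rewrite ler_wpM2r // lerDl.
  by rewrite mulrC -ler_pdivlMr // ltr_wpDl.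
exact: (cvg_unique _ Pw Pw0).
Unshelve. all: by end_near. Qed.

Lemma vanishing_cst (R : realType) (n : nat) (p : 'rV[R]_n) (a : R) :
  vanishing (fun=> a) p 0.
Proof. by exists `|a|, 1; split=> // x _; rewrite expr0 mulr1. Qed.

Lemma vanishing0 (R : realType) (n : nat) (p : 'rV[R]_n) m :
  vanishing (fun=> 0 : R) p m.
Proof. by exists 0, 1; split=> // x _; rewrite normr0 mul0r. Qed.

Lemma vanishingD (R : realType) (n : nat) (f g : 'rV[R]_n -> R) (p : 'rV[R]_n) m :
  vanishing f p m -> vanishing g p m -> vanishing (fun y => f y + g y) p m.
Proof.
move=> [C [d [C0 d0 fC]]] [C' [d' [C'0 d'0 gC]]].
exists (C + C'), (Num.min d d'); split; rewrite ?addr_ge0 ?lt_min ?d0 //.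
move=> x; rewrite le_min => /andP[xd xd']; apply: le_trans (ler_normD _ _) _.
by rewrite mulrDl; apply: lerD; [exact: fC | exact: gC].
Qed.

Lemma vanishingM (R : realType) (n : nat) (f g : 'rV[R]_n -> R) (p : 'rV[R]_n) k l :
  vanishing f p k -> vanishing g p l -> vanishing (fun y => f y * g y) p (k + l).
Proof.
move=> [C [d [C0 d0 fC]]] [C' [d' [C'0 d'0 gC]]].
exists (C * C'), (Num.min d d'); split; rewrite ?mulr_ge0 ?lt_min ?d0 //.
move=> x; rewrite le_min => /andP[xd xd']; rewrite normrM exprD mulrACA.
by apply: ler_pM => //; [exact: fC | exact: gC].
Qed.

Lemma vanishing_sum (R : realType) (n : nat) (I : Type) (s : seq I)
    (f : I -> 'rV[R]_n -> R) (p : 'rV[R]_n) m :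
  (forall i, vanishing (f i) p m) ->
  vanishing (fun y => \sum_(i <- s) f i y) p m.
Proof.
move=> fv; elim: s => [|i s IH].
  rewrite (_ : (fun _ => _) = fun=> 0); first exact: vanishing0.
  by apply/funext => y; rewrite big_nil.
rewrite (_ : (fun _ => _) = fun y => f i y + \sum_(i <- s) f i y).
  exact: vanishingD.
by apply/funext => y; rewrite big_cons.
Qed.

Lemma vanishingW (R : realType) (n : nat) (f : 'rV[R]_n -> R) (p : 'rV[R]_n) k m :
  (k <= m)%N -> vanishing f p m -> vanishing f p k.
Proof.
move=> km [C [d [C0 d0 fC]]]; exists C, (Num.min d 1).
split; rewrite ?lt_min ?d0 ?ltr01 // => x; rewrite le_min => /andP[xd x1].
by apply: le_trans (fC x xd) _; rewrite ler_wpM2l // ler_wiXn2l.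
Qed.

(** The constant term of the expansion is [f p]: the remainder bound of order one
is zero at the centre. *)
Lemma analytic_vanishing_sub (R : realType) (n : nat) (f : 'rV[R]_n -> R)
    (p : 'rV[R]_n) :
  analytic_at f p -> vanishing (fun y => f y - f p) p 1.
Proof.
move=> /analytic_taylor[P [r [B [[r0 B0] _ PZ PB]]]].
have P0 x : P 0 x = f p.
  have P00 : P 0 x = P 0 0 by have := PZ 0 0 x; rewrite scale0r expr0 mul1r.
  have := PB 1%N 0; rewrite normr0 => /(_ (ltW r0)).
  rewrite mul0r expr1 mulr0 addr0 big_ord1 normr_le0 subr_eq0 => /eqP ->.
  exact: P00.
exists (B / r), r; split; rewrite ?divr_ge0 // ?ltW // => x xr.
by have := PB 1%N x xr; rewrite big_ord1 P0 !expr1; lra.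
Qed.

Lemma vanishing_le (R : realType) (n : nat) (f g : 'rV[R]_n -> R)
    (p : 'rV[R]_n) m :
  (forall y, `|f y| <= `|g y|) -> vanishing g p m -> vanishing f p m.
Proof.
move=> fg [C [d [C0 d0 gC]]]; exists C, d; split=> // x xd.
exact: le_trans (fg _) (gC x xd).
Qed.

Lemma vanishing_comp (R : realType) (n m : nat) (h : 'rV[R]_m -> R)
    (xi : 'rV[R]_n -> 'rV[R]_m) (z : 'rV[R]_m) (p : 'rV[R]_n) :
  analytic_at h z ->
  (forall k, vanishing (fun y => xi y 0 k - z 0 k) p 1) ->
  vanishing (fun y => h (xi y) - h z) p 1.
Proof.
move=> /analytic_vanishing_sub[C [d [C0 d0 hC]]] xiv.
have : vanishing (fun y => \sum_k `|xi y 0 k - z 0 k|) p 1.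
  apply: vanishing_sum => k; apply: (vanishing_le _ (xiv k)) => y.
  by rewrite normr_id.
move=> [C' [d' [C'0 d'0 xiC]]].
exists (C * C'), (Num.min d' (d / (C' + 1))).
have C'1 : 0 < C' + 1 by rewrite ltr_wpDl.
split; rewrite ?mulr_ge0 ?lt_min ?d'0 ?divr_gt0 // => x.
rewrite le_min => /andP[xd']; rewrite ler_pdivlMr // => xd.
have zx : `|xi (p + x) - z| <= C' * `|x|.
  have := xiC x xd'; rewrite expr1; apply: le_trans.
  rewrite ger0_norm ?sumr_ge0 //; apply: norm_row_le; first exact: sumr_ge0.
  by move=> k; rewrite (bigD1 k) //= !mxE lerDl sumr_ge0.
have zd : `|xi (p + x) - z| <= d.
  apply: le_trans zx _; apply: le_trans xd; rewrite mulrC.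
  by rewrite ler_wpM2l // lerDl.
have := hC _ zd; rewrite addrCA subrr addr0 !expr1 => hz.
by apply: le_trans hz _; rewrite -mulrA ler_wpM2l.
Qed.

(** * Raising the order of vanishing *)

(** Over a real field the kernel of [A] is the orthogonal complement of its row
space: a vector in both has square norm zero, and the dimensions add up. *)
Lemma kernel_row_decomposition (R : realFieldType) (n : nat) (A : 'M[R]_n)
    (x : 'rV[R]_n) :
  exists b z : 'rV[R]_n, A *m z^T = 0 /\ x = z + b *m A.
Proof.
have cap0 : (kermx A^T :&: A)%MS = 0.
  apply/eqP/rowV0P => u; rewrite sub_capmx => /andP[/sub_kermxP uA /submxP[b uE]].
  have uu : u *m u^T = 0.
    by rewrite {1}uE -mulmxA -[A *m _]trmxK trmx_mul trmxK uA trmx0 mulmx0.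
  apply/rowP => i; rewrite mxE; apply/eqP; rewrite -sqrf_eq0 expr2.
  have /eqP := congr1 (fun M : 'M[R]_1 => M 0 0) uu; rewrite !mxE.
  rewrite psumr_eq0; last by move=> k _; rewrite !mxE -expr2 sqr_ge0.
  by move=> /allP /(_ i); rewrite mem_index_enum mxE => /(_ isT).
have full : row_full (kermx A^T + A)%MS.
  rewrite /row_full -(eqn_add2r (\rank (kermx A^T :&: A)%MS)) mxrank_sum_cap cap0.
  by rewrite mxrank0 addn0 mxrank_ker mxrank_tr subnK // rank_leq_row.
have /sub_addsmxP[[b1 b] /= xE] : (x <= kermx A^T + A)%MS by exact: submx_full.
exists b, (b1 *m kermx A^T); split=> //.
by rewrite -[A *m _]trmxK trmx_mul trmxK -mulmxA mulmx_ker mulmx0 trmx0.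
Qed.

(** The mean value theorem on the segment from [p + t *: x] to [p + t *: (x + z)]
bounds the difference of the values of [f] by [t * O(t ^ k)], so the terms of
degree [k] at both ends agree. *)
Lemma taylor_term_shift (R : realType) (n : nat) (f : 'rV[R]_n -> R^o)
    (p x z : 'rV[R]_n) P (r B : R) (k : nat) :
  (forall y, differentiable f y) ->
  taylor_expansion f p P r B -> (forall l x, (l < k)%N -> P l x = 0) ->
  vanishing ('D_z f) p k -> P k (x + z) = P k x.
Proof.
move=> df fP P0 [C [d [C0 d0 fC]]].
have [[r0 B0] dP PZ _] := fP.
pose N := `|x| + `|z| + 1; have N0 : 0 < N by rewrite ltr_wpDl // addr_ge0.
pose K := C * N ^+ k + (B * (N / r) ^+ k.+1) *+ 2.
apply/eqP; rewrite -subr_eq0; apply/eqP.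
apply: (@eq0_le_small _ _ K (Num.min (d / N) (r / N))).
  by rewrite lt_min !divr_gt0.
move=> t; rewrite lt_min => /andP[t0 /andP[]]; rewrite !ltr_pdivlMr // => td tr.
have tN (y : 'rV[R]_n) : `|y| <= N -> `|t *: y| <= t * N by move=> yN; rewrite normrZ gtr0_norm // ler_pM2l.
have xN : `|x| <= N by rewrite /N -addrA lerDl addr_ge0.
have xzN s : 0 <= s <= 1 -> `|x + s *: z| <= N.
  move=> /andP[s0 s1]; apply: le_trans (ler_normD _ _) _.
  rewrite /N -addrA lerD2l normrZ ger0_norm // -[leLHS]addr0; apply: lerD => //.
  by rewrite ler_piMl.
have fk (y : 'rV[R]_n) : `|y| <= N ->
    `|f (p + t *: y) - t ^+ k * P k y| <= B * (t * N / r) ^+ k.+1.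
  move=> yN; rewrite -PZ.
  have lb := taylor_leading_bound fP P0 (le_trans (tN y yN) (ltW tr)).
  apply: le_trans lb _.
  rewrite ler_wpM2l //; apply: lerXn2r;
    rewrite ?nnegrE ?divr_ge0 ?mulr_ge0 ?(ltW t0) ?(ltW N0) ?(ltW r0) //.
  by rewrite ler_pM2r ?invr_gt0 // tN.
have [s s01] := mvt_line (p + t *: x) (t *: z) df.
have -> : p + t *: x + s *: (t *: z) = p + t *: (x + s *: z).
  by rewrite scalerDr addrA !scalerA (mulrC s t).
rewrite -addrA -scalerDr deriveE // linearZ /= -deriveE // => fd.
have db : `|t *: 'D_z f (p + t *: (x + s *: z))| <= t * (C * (t * N) ^+ k).
  rewrite normrZ gtr0_norm // ler_pM2l //.
  have yN := xzN s s01.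
  apply: le_trans (fC _ (le_trans (tN _ yN) (ltW td))) _; rewrite ler_wpM2l //.
  by apply: lerXn2r; rewrite ?nnegrE ?mulr_ge0 ?(ltW t0) ?(ltW N0) // tN.
have xz1 : `|x + z| <= N by have := xzN 1; rewrite scale1r; apply; rewrite ler01 lexx.
have b1 := fk _ xN; have b2 := fk _ xz1; rewrite -fd in db.
have tk : 0 < t ^+ k by rewrite exprn_gt0.
rewrite -(@ler_pM2l _ (t ^+ k)) //.
have -> : t ^+ k * `|P k (x + z) - P k x| = `|t ^+ k * (P k (x + z) - P k x)|.
  by rewrite normrM (gtr0_norm tk).
have -> : t ^+ k * (P k (x + z) - P k x) =
    (f (p + t *: (x + z)) - f (p + t *: x))
    - (f (p + t *: (x + z)) - t ^+ k * P k (x + z))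
    + (f (p + t *: x) - t ^+ k * P k x) by ring.
have -> : t ^+ k * (K * t) = t * (C * (t * N) ^+ k) + B * (t * N / r) ^+ k.+1
    + B * (t * N / r) ^+ k.+1.
  rewrite /K -(mulrA t); move: (N / r) => q.
  by rewrite mulr2n !exprMn !exprS; ring.
apply: le_trans (ler_normD _ _) _; apply: lerD => //.
by apply: le_trans (ler_normB _ _) _; apply: lerD.
Qed.

(** The term of degree [k] of [d i] is invariant under the row space of [A]: by the
symmetry of the derivatives, the derivative of [d i] along [b *m A] is a partial
derivative of the combination [f] of the rows of [A d], which vanishes to order
[k.+1].  On the kernel of [A] the term is zero because of the curves. *)
Lemma vanishing_order_step (R : realType) (n : nat) (d : 'I_n -> 'rV[R]_n -> R^o)
    (p : 'rV[R]_n) (A : 'M[R]_n) (sg : R) (k : nat) :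
  (forall i x, analytic_at (d i) x) ->
  (forall i j x, 'D_(delta_mx 0 i) (d j) x = sg * 'D_(delta_mx 0 j) (d i) x) ->
  (forall i, vanishing (d i) p k) ->
  (forall i, vanishing (fun y => \sum_j A i j * d j y) p k.+1) ->
  (forall v, A *m v^T = 0 -> exists c : R -> 'rV[R]_n,
     [/\ c 0 = p, \forall t \near (0 : R), forall i, d i (c t) = 0 &
         is_derive (0 : R^o) (1 : R^o) c v]) ->
  forall i, vanishing (d i) p k.+1.
Proof.
move=> dan dsym dv Ad curves i.
have ddiff j y : differentiable (d j) y by exact: analytic_differentiable.
have [P [r [B dP]]] := analytic_taylor (dan i p).
have P0 l x : (l < k)%N -> P l x = 0 by exact: vanishing_terms dP (dv i) l x.
apply: (terms_vanishing dP) => l x; rewrite ltnS leq_eqVlt => /orP[/eqP->|]; last exact: P0.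
have [b [z [Az ->]]] := kernel_row_decomposition A x.
set w := b *m A.
have [c [c0 cd cz]] := curves z Az.
rewrite (@taylor_term_shift _ _ (d i) p z w P r B k) //.
  apply: taylor_leading_curve dP P0 c0 _ cz.
  by near=> t; have : forall j, d j (c t) = 0 by near: t.
pose f y := \sum_(l <- index_enum 'I_n) b 0 l * (\sum_j A l j * d j y).
have fan y : analytic_at f y.
  by apply: analytic_at_sum => m; exact: analytic_at_sum.
have fv : vanishing f p k.+1.
  apply: vanishing_sum => m; apply: (@vanishingM _ _ _ _ _ 0 k.+1) => //.
  exact: vanishing_cst.
have fE : f = (fun y => \sum_j w 0 j * d j y).
  apply/funext => y; rewrite /f.
  under eq_bigr do rewrite mulr_sumr.
  rewrite exchange_big /=; apply: eq_bigr => j _.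
  by rewrite mxE mulr_suml; apply: eq_bigr => m _; rewrite mulrA.
have dE : 'D_w (d i) = fun y => sg * 'D_(delta_mx 0 i) f y.
  apply/funext => y; rewrite derive_sum_coord // fE.
  have -> : (fun y => \sum_j w 0 j * d j y) = \sum_(j < n) (w 0 j \*: d j).
    by apply/funext => u; rewrite fct_sumE.
  rewrite derive_sum; last by move=> j; apply/derivableZ/diff_derivable.
  rewrite mulr_sumr; apply: eq_bigr => j _.
  have -> : 'D_(delta_mx 0 i) (w 0 j \*: d j) y = w 0 j * 'D_(delta_mx 0 i) (d j) y.
    by apply: deriveZ; exact: diff_derivable.
  by rewrite (dsym j i) mulrCA.
rewrite dE; apply: (@vanishingM _ _ _ _ _ 0 k); first exact: vanishing_cst.
exact: vanishing_derive fan fv.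
Unshelve. all: by end_near. Qed.

(** * The identity theorem *)

(** The zero values along one side of [x] force every homogeneous part to vanish at
[- v], hence by homogeneity at [v]. *)
Lemma analytic_zero_continues (R : realType) (n : nat) (f : 'rV[R]_n -> R)
    (x v : 'rV[R]_n) (d : R) :
  analytic_at f x -> 0 < d ->
  (forall s, 0 < s < d -> f (x - s *: v) = 0) ->
  exists2 d', 0 < d' & forall s, 0 <= s < d' -> f (x + s *: v) = 0.
Proof.
move=> /analytic_taylor[P [r [B fP]]] d0 f0.
have [[r0 _] _ PZ _] := fP.
have Pv k : P k v = 0.
  have : P k (- v) = 0.
    apply: (@taylor_terms_vanish_along _ _ _ _ _ _ _ (- v) k.+1 0 d fP d0 _ _ (ltnSn k)).
    by move=> t td; rewrite scalerN f0 // normr0 mul0r.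
  rewrite -scaleN1r PZ => /eqP; rewrite mulf_eq0 expf_eq0 oppr_eq0 oner_eq0 andbF /=.
  by move/eqP.
have v1 : 0 < `|v| + 1 by rewrite ltr_wpDl.
exists (r / (`|v| + 1)); first by rewrite divr_gt0.
move=> s /andP[s0]; rewrite ltr_pdivlMr // => sr.
apply: (taylor_terms0 fP) => [k|]; first by rewrite PZ Pv mulr0.
rewrite normrZ ger0_norm //; apply: le_lt_trans sr.
by rewrite ler_wpM2l // lerDl.
Qed.

(** On the segment from [p] to [y], the supremum of the times up to which [f]
vanishes cannot be smaller than [1], since the vanishing continues beyond it. *)
Lemma analytic_identity (R : realType) (n : nat) (f : 'rV[R]_n -> R)
    (p : 'rV[R]_n) (d : R) :
  (forall x, analytic_at f x) -> 0 < d ->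
  (forall x, `|x| < d -> f (p + x) = 0) -> forall y, f y = 0.
Proof.
move=> fan d0 f0 y; pose v := y - p.
pose E := [set t : R | 0 <= t <= 1 /\ forall s, 0 <= s <= t -> f (p + s *: v) = 0].
have v1 : 0 < `|v| + 1 by rewrite ltr_wpDl.
have E0 : E 0.
  split; first by rewrite lexx ler01.
  by move=> s /le_anti <-; rewrite scale0r f0 // normr0.
have E1 : ubound E 1 by move=> t [/andP[]].
have supE : has_sup E by split; [exists 0 | exists 1].
set T := sup E.
have T1 : T <= 1 by apply: ge_sup => //; exists 0.
have below s : 0 <= s -> s < T -> f (p + s *: v) = 0.
  move=> s0 sT; have [t [_ Et] st] := sup_adherent (eps := T - s) ltac:(by rewrite subr_gt0) supE.
  apply: Et; rewrite s0 /=; move: st; rewrite -/T; lra.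
have T0 : 0 < T.
  pose t := Num.min 1 (d / (`|v| + 1) / 2).
  have t0 : 0 < t by rewrite lt_min ltr01 !divr_gt0.
  apply: (lt_le_trans t0); apply: ub_le_sup => //; first by exists 1.
  split; first by rewrite ltW //= ge_min lexx.
  move=> s /andP[s0 st]; apply: f0; rewrite normrZ ger0_norm //.
  have : s <= d / (`|v| + 1) / 2 by apply: le_trans st _; rewrite ge_min lexx orbT.
  rewrite !ler_pdivlMr // => sd.
  have : s * `|v| <= s * (`|v| + 1) by rewrite ler_wpM2l // lerDl.
  have := d0; nra.
have [d' d'0 after] : exists2 d', 0 < d' &
    forall s, 0 <= s < d' -> f (p + T *: v + s *: v) = 0.
  apply: (@analytic_zero_continues _ _ f _ v T) => // s /andP[s0 sT].
  rewrite -addrA -scalerBl; apply: below; lra.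
have yE : y = p + 1 *: v by rewrite scale1r /v addrCA subrr addr0.
have [T_lt1|] := ltP T 1; last first.
  move=> T_ge1; have TE : T = 1 by apply/le_anti; rewrite T1.
  by have := after 0; rewrite lexx d'0 scale0r addr0 TE -yE; apply.
pose t := Num.min 1 (T + d' / 2).
have Tt : T < t by rewrite lt_min T_lt1 ltrDl divr_gt0.
have tE : E t.
  split; first by rewrite ge_min lexx andbT ltW // (lt_trans T0).
  move=> s /andP[s0 st]; have [sT|Ts] := ltP s T; first exact: below.
  have -> : s = T + (s - T) by ring.
  rewrite scalerDl addrA; apply: after.
  have : s <= T + d' / 2 by apply: le_trans st _; rewrite ge_min lexx orbT.
  by move: Ts d'0; lra.
have : t <= T by apply: ub_le_sup => //; exists 1.
by rewrite leNgt Tt.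
Qed.

(** * The difference of two fields with the same conservation law *)

(** Partial derivatives in the first argument are directional derivatives of the
function of the joined vector, to which joint analyticity applies. *)
Lemma derive_first_argument (R : realType) (n : nat)
    (H : 'rV[R]_n -> 'rV[R]_n -> R^o) (v w : 'rV[R]_n) (i : 'I_n) :
  'D_(delta_mx 0 i) (H^~ w) v =
  'D_(delta_mx 0 (lshift n i))
    (fun y : 'rV[R]_(n + n) => H (lsubmx y) (rsubmx y) : R^o) (row_mx v w).
Proof.
have -> : delta_mx 0 (lshift n i) = row_mx (delta_mx 0 i) 0 :> 'rV[R]_(n + n).
  apply/rowP => k; rewrite !mxE; case: split_ordP => l ->; rewrite !mxE ?eqxx /=.
    by rewrite (inj_eq (@lshift_inj _ _)).
  by rewrite eq_rlshift.
rewrite /derive; set d := (fun _ : R => _); set d' := (fun _ : R => _).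
suff -> : d = d' by []; apply/funext => h; rewrite /d /d' /=.
by rewrite scale_row_mx add_row_mx scaler0 add0r !row_mxKl !row_mxKr.
Qed.

Lemma hessian_first_argument (R : realType) (n : nat)
    (H : 'rV[R]_n -> 'rV[R]_n -> R^o) (v w : 'rV[R]_n) (i j : 'I_n) :
  hessian (H^~ w) v i j =
  'D_(delta_mx 0 (lshift n i)) ('D_(delta_mx 0 (lshift n j))
    (fun y : 'rV[R]_(n + n) => H (lsubmx y) (rsubmx y) : R^o)) (row_mx v w).
Proof.
rewrite mxE; set H2 := fun _ : 'rV_(n + n) => _.
set g := 'D_(delta_mx 0 (lshift n j)) H2.
have -> : 'D_(delta_mx 0 j) (H^~ w) = (fun u y => g (row_mx u y))^~ w.
  by apply/funext => u; exact: derive_first_argument.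
have gE : (fun y : 'rV[R]_(n + n) => g (row_mx (lsubmx y) (rsubmx y))) = g.
  by apply/funext => y; rewrite hsubmxK.
by have := derive_first_argument (fun u y => g (row_mx u y)) v w i; rewrite gE.
Qed.

(** For each [w] the mean value theorem, applied to the [i]-th partial derivative
[g] of [H] in its first argument between [(F w, w)] and [(G w, w)], gives a point
[xi] with [\sum_j d_j(w) * D_j g (xi) = 0].  Replacing [xi] by the base point
[(F p, p)] changes each factor [D_j g] by [O(|w - p|)] and thus the sum by one
order more than [d].  Commutation of partial derivatives identifies
[D_j g (F p, p)] with the entry [(i, j)] of the Hessian. *)
Lemma hessian_kills_difference (R : realType) (n : nat)
    (F G : 'rV[R]_n -> 'rV[R]_n) (H : 'rV[R]_n -> 'rV[R]_n -> R)
    (p : 'rV[R]_n) (k : nat) :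
  analytic_function2 H -> analytic_field F ->
  conservation_law H F -> conservation_law H G ->
  (0 < k)%N -> (forall j, vanishing (fun y => G y 0 j - F y 0 j) p k) ->
  forall i, vanishing
    (fun y => \sum_j hessian (H^~ p) (F p) i j * (G y 0 j - F y 0 j)) p k.+1.
Proof.
move=> Han Fan HF HG k0 dv i.
pose H2 (y : 'rV[R]_(n + n)) : R^o := H (lsubmx y) (rsubmx y).
pose g := 'D_(delta_mx 0 (lshift n i)) H2.
pose h j := 'D_(delta_mx 0 (lshift n j)) g.
have gan : forall y, analytic_at g y := analytic_derive (lshift n i) Han.
have han j : forall y, analytic_at (h j) y := analytic_derive (lshift n j) gan.
have gdiff y : differentiable g y by exact: analytic_differentiable.
pose z := row_mx (F p) p.
have hz j : hessian (H^~ p) (F p) i j = h j z.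
  rewrite hessian_first_argument /h /g /z.
  exact: (analytic_derive_comm (lshift n i) (lshift n j) (row_mx (F p) p) Han).
have g0 K w : conservation_law H K -> g (row_mx (K w) w) = 0.
  move=> /(_ w) /rowP /(_ i); rewrite !mxE => Kw.
  by rewrite -[RHS]Kw [RHS](derive_first_argument H).
pose xi s w := row_mx (F w) w + s *: row_mx (G w - F w) 0.
have xiR t w l : xi t w 0 (rshift n l) = w 0 l.
  by rewrite /xi mxE row_mxEr [X in _ + X]mxE row_mxEr mxE mulr0 addr0.
have xiL t w l : xi t w 0 (lshift n l) = F w 0 l + t * (G w 0 l - F w 0 l).
  by rewrite /xi mxE row_mxEl [X in _ + X]mxE row_mxEl !mxE.
have mv w : exists s : R, 0 <= s <= 1 /\
    \sum_j (G w 0 j - F w 0 j) * h j (xi s w) = 0.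
  have [s s01] := mvt_line (row_mx (F w) w) (row_mx (G w - F w) 0) gdiff.
  rewrite add_row_mx addr0 addrCA subrr addr0 !g0 // subrr => E; exists s; split=> //.
  rewrite [RHS]E derive_sum_coord // big_split_ord /=.
  rewrite [X in _ = _ + X]big1 ?addr0; last first.
    by move=> j _; rewrite row_mxEr mxE mul0r.
  by apply: eq_bigr => j _; rewrite row_mxEl !mxE.
have [s sP] := choice mv.
have -> : (fun y => \sum_j hessian (H^~ p) (F p) i j * (G y 0 j - F y 0 j)) =
    (fun y => \sum_j (G y 0 j - F y 0 j) * (- (h j (xi (s y) y) - h j z))).
  apply/funext => y; have [_ sum0] := sP y.
  apply/eqP; rewrite -subr_eq0 -sumrB -[X in _ == X]sum0; apply/eqP.
  apply: eq_bigr => j _; rewrite hz; move: (h j z) (h j (xi _ _)) (G y 0 j - F y 0 j) => a b e.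
  by ring.
apply: vanishing_sum => j; rewrite -(addn1 k); apply: vanishingM => //.
apply: (@vanishing_le _ _ _ (fun y => h j (xi (s y) y) - h j z)).
  by move=> y; rewrite normrN.
apply: (vanishing_comp (xi := fun y => xi (s y) y)) => // l.
have [l1 ->|l2 ->] := split_ordP l; last first.
  exists 1, 1; split=> // x _.
  rewrite xiR /z row_mxEr !mxE addrAC subrr add0r.
  by rewrite mul1r expr1 norm_coord.
have -> : (fun y => xi (s y) y 0 (lshift n l1) - z 0 (lshift n l1)) =
   (fun y => (F y 0 l1 - F p 0 l1) + s y * (G y 0 l1 - F y 0 l1)).
  by apply/funext => y; rewrite xiL /z row_mxEl; ring.
apply: vanishingD.
  by apply: (@analytic_vanishing_sub _ _ (fun y => F y 0 l1)); apply: Fan.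
apply: vanishing_le (vanishingW k0 (dv l1)) => y.
have [/andP[s0 s1] _] := sP y.
by rewrite normrM ger0_norm // ler_piMl.
Qed.

Lemma analytic_field_differentiable (R : realType) (n : nat)
    (F : 'rV[R]_n -> 'rV[R]_n) (x : 'rV[R]_n) :
  analytic_field F -> differentiable F x.
Proof.
move=> Fan.
have -> : F = \sum_(j < n) (fun y => F y 0 j *: delta_mx 0 j).
  by apply/funext => y; rewrite fct_sumE {1}[F y]row_sum_delta.
apply: differentiable_sum => j; apply: differentiableZl.
exact: (@analytic_differentiable _ _ (fun y => F y 0 j)) (Fan x I j).
Qed.

(** Jacobian matrices act on row vectors here, so the direction of differentiation
is the row index. *)
Lemma jacobian_coord (R : realType) (n : nat) (F : 'rV[R]_n -> 'rV[R]_n)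
    (x : 'rV[R]_n) (i j : 'I_n) :
  analytic_field F ->
  'J F x i j = 'D_(delta_mx 0 i) (fun y => F y 0 j : R^o) x.
Proof.
move=> Fan; have dF := analytic_field_differentiable x Fan.
transitivity (((delta_mx 0 i : 'rV[R]_n) *m 'J F x) 0 j); first by rewrite -rowE [RHS]mxE.
by rewrite -deriveEjacobian // derive_mx ?mxE //; exact: diff_derivable.
Qed.

Lemma solution_eq_on_closure (R : realType) (n : nat) (F G : 'rV[R]_n -> 'rV[R]_n)
    (I : set R) (u : R -> 'rV[R]_n) :
  analytic_field F -> analytic_field G -> solution F I u -> solution G I u ->
  closure (u @` I) `<=` [set x | G x = F x].
Proof.
move=> Fan Gan [_ _ _ uF] [_ _ _ uG] x ux.
have FGc : closed [set x | G x = F x].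
  have -> : [set x | G x = F x] = (fun x => G x - F x) @^-1` [set 0].
    apply/seteqP; split=> y /=; first by move=> ->; rewrite subrr.
    by move/eqP; rewrite subr_eq0 => /eqP.
  apply: closed_comp; last by apply: accessible_closed_set1; exact: hausdorff_accessible.
  move=> y _; apply: continuousB; apply: differentiable_continuous;
    exact: analytic_field_differentiable.
rewrite ((closure_id [set x | G x = F x]).1 FGc).
apply: closure_subset ux => y /= [t It <-].
have [_ <-] := uF t It; have [_ <-] := uG t It; by [].
Qed.

(** The sign [sg] is [1] for symmetric and [- 1] for skew-symmetric Jacobians. *)
Lemma conservation_law_determines (R : realType) (n : nat) (sg : R)
    (F G : 'rV[R]_n -> 'rV[R]_n) (H : 'rV[R]_n -> 'rV[R]_n -> R)
    (I : set R) (u : R -> 'rV[R]_n) (S : set 'rV[R]_n) (p : 'rV[R]_n) :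
  analytic_field F -> analytic_field G -> analytic_function2 H ->
  (forall x, ('J F x)^T = sg *: 'J F x) ->
  (forall x, ('J G x)^T = sg *: 'J G x) ->
  conservation_law H F -> conservation_law H G ->
  solution F I u -> solution G I u ->
  S p -> S `<=` closure (u @` I) ->
  [set v : 'rV[R]_n | hessian (H^~ p) (F p) *m v^T = 0] `<=` tangent_space S p ->
  G = F.
Proof.
move=> Fan Gan Han JF JG HF HG uF uG Sp Su kerS.
pose d j (y : 'rV[R]_n) : R^o := G y 0 j - F y 0 j.
have GF : S `<=` [set x | G x = F x].
  by apply: subset_trans Su _; exact: solution_eq_on_closure.
have Fj j y : analytic_at (fun y => F y 0 j) y by exact: Fan.
have Gj j y : analytic_at (fun y => G y 0 j) y by exact: Gan.
have dan j y : analytic_at (d j) y.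
  rewrite (_ : d j = fun y => G y 0 j + (- 1) * F y 0 j).
    exact: analytic_at_lincomb.
  by apply/funext => w; rewrite mulN1r.
have dS j x : S x -> d j x = 0 by move=> /GF /= GFx; rewrite /d GFx subrr.
have dD i j x : 'D_(delta_mx 0 i) (d j) x = 'J G x i j - 'J F x i j.
  have jG := jacobian_coord x i j Gan; have jF := jacobian_coord x i j Fan.
  apply: eq_trans (congr2 (fun a b => a - b) (esym jG) (esym jF)).
  have dG := diff_derivable (v := delta_mx 0 i) (analytic_differentiable (Gj j x)).
  have dF := diff_derivable (v := delta_mx 0 i) (analytic_differentiable (Fj j x)).
  exact: (deriveB dG dF).
have flip (K : 'M[R]_n) : K^T = sg *: K -> forall i j, K i j = sg * K j i.
  by move=> /matrixP KE i j; have := KE j i; rewrite !mxE.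
have dsym i j x : 'D_(delta_mx 0 i) (d j) x = sg * 'D_(delta_mx 0 j) (d i) x.
  have sub_flip (a b a' b' : R) :
      a = sg * a' -> b = sg * b' -> a - b = sg * (a' - b').
    by move=> -> ->; rewrite mulrBr.
  have JE := sub_flip _ _ _ _ (flip _ (JG x) i j) (flip _ (JF x) i j).
  exact: (eq_trans (dD i j x) (eq_trans JE (congr1 ( *%R sg) (esym (dD j i x))))).
have dv k : forall j, vanishing (d j) p k.+1.
  elim: k => [|k IH] j.
    have := analytic_vanishing_sub (dan j p); rewrite dS //.
    by under eq_fun do rewrite subr0.
  apply: (@vanishing_order_step _ _ d p (hessian (H^~ p) (F p)) sg) => //.
    exact: hessian_kills_difference.
  move=> v /kerS[c [c0 cS cv]]; exists c; split=> //.
  by near=> t => i; apply: dS; have [] : S (c t) /\ derivable c t 1 by near: t.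
apply/funext => y; apply/rowP => j; apply/eqP; rewrite -subr_eq0; apply/eqP.
have dp m : vanishing (d j) p m by apply: vanishingW (dv m j).
have [e e0 de] := vanishing_analytic_eq0 (dan j p) dp.
exact: (@analytic_identity _ _ (d j) p e).
Unshelve. all: by end_near. Qed.

Theorem theorem6p3 (R : realType) (n : nat)
    (F : 'rV[R]_n -> 'rV[R]_n) (H : 'rV[R]_n -> 'rV[R]_n -> R)
    (F_analytic : analytic_field F)
    (H_analytic : analytic_function2 H)
    (F_conserves : conservation_law H F)
    (traj : exists (I : set R) (u : R -> 'rV[R]_n)
                   (S : set 'rV[R]_n) (p : 'rV[R]_n),
        [/\ solution F I u, analytic_submanifold S, S p,
            S `<=` closure (u @` I) &
            [set v : 'rV[R]_n | hessian (H^~ p) (F p) *m v^T = 0]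
              `<=` tangent_space S p]) :
  ((forall x : 'rV[R]_n, ('J F x)^T = 'J F x) ->
     discoverable (@symmetric_fields R n) F H) /\
  ((forall x : 'rV[R]_n, ('J F x)^T = - 'J F x) ->
     discoverable (@skew_symmetric_fields R n) F H).
Proof.
have [I [u [S [p [uF _ Sp Su kerS]]]]] := traj.
split=> JF; exists I, u; (split; first exact: uF).
- move=> G; split=> [[[Gan JG] uG HG]|->].
    exact: (conservation_law_determines F_analytic Gan H_analytic
      (fun x => eq_trans (JF x) (esym (scale1r _)))
      (fun x => eq_trans (JG x) (esym (scale1r _)))
      F_conserves HG uF uG Sp Su kerS).
  by split; [split; [exact: F_analytic | exact: JF] | exact: uF | exact: F_conserves].
- move=> G; split=> [[[Gan JG] uG HG]|->].
    exact: (conservation_law_determines F_analytic Gan H_analytic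
      (fun x => eq_trans (JF x) (esym (scaleN1r _)))
      (fun x => eq_trans (JG x) (esym (scaleN1r _)))
      F_conserves HG uF uG Sp Su kerS).
  by split; [split; [exact: F_analytic | exact: JF] | exact: uF | exact: F_conserves].
Qed.
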